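(* Let $K$ be a field, $S=K[x_1,\dots,x_n]$, and let $I\subseteq S$ be a right PLP-polymatroidal ideal. Then $\operatorname{astab}(I)=\operatorname{dstab}(I)$.
   Context: For a monomial ideal $I\subseteq S$, $\operatorname{dstab}(I)$ (resp. $\operatorname{astab}(I)$) is the smallest positive integer $m$ such that $\operatorname{depth} S/I^m=\operatorname{depth} S/I^\ell$ (resp. $\operatorname{Ass}(S/I^m)=\operatorname{Ass}(S/I^\ell)$) for all $\ell\ge m$. Right PLP-polymatroidal ideal: let $n,k,d$ be positive integers with $1\le k\le n-1$, let $\alpha_i,\beta_i$ $(1\le i\le k)$ be non-negative integers with $\alpha_i\le\beta_i$ for all $i$, $\alpha_1\le\cdots\le\alpha_k\le d$, $0<\beta_1\le\cdots\le\beta_k\le d$, and let $b_{k+1},\dots,b_n$ be positive integers with $d\le\beta_k+b_{k+1}+\cdots+b_n$. The corresponding right PLP-polymatroidal ideal $I$ is the (nonzero) monomial ideal of $S$ generated by all $x_1^{u_1}\cdots x_n^{u_n}$, with $u_i$ non-negative integers, such that $\alpha_i\le u_1+\cdots+u_i\le\beta_i$ for $i=1,\dots,k$, $0\le u_i\le b_i$ for $i=k+1,\dots,n$, and $u_1+\cdots+u_n=d$. *)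

(* Defs.v *)
From HB Require Import structures.
From mathcomp Require Import all_boot all_order all_algebra.
From mathcomp Require Import mpoly.

Set Implicit Arguments.
Unset Strict Implicit.
Unset Printing Implicit Defensive.

Import GRing.Theory.
Local Open Scope ring_scope.

(* Subsets of S are Prop-valued predicates, compared pointwise; the quotient  *)
(* S/J is never built, statements about it being read on representatives.     *)
Section Ideals.
Variable S : comNzRingType.
Implicit Types (G I J P : S -> Prop) (s : seq S).

Definition is_ideal J : Prop :=
  [/\ J 0, (forall f g, J f -> J g -> J (f + g))
    & forall c f, J f -> J (c * f)].

Definition is_prime_ideal P : Prop :=
  [/\ is_ideal P, ~ P 1 & forall f g, P (f * g) -> P f \/ P g].

Definition ideal_gen G : S -> Prop := fun f =>
  exists (r : nat) (c g : 'I_r -> S),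
    (forall i, G (g i)) /\ f = \sum_(i < r) c i * g i.

Definition ideal_exp I (m : nat) : S -> Prop :=
  ideal_gen (fun h => exists f : 'I_m -> S,
    (forall i, I (f i)) /\ h = \prod_(i < m) f i).

Definition ideal_adjoin J s : S -> Prop := ideal_gen (fun f => J f \/ f \in s).

(* P is in Ass(S/J): P is prime and is the annihilator of the class of g.     *)
Definition in_Ass J P : Prop :=
  is_prime_ideal P /\ exists g, forall f, P f <-> J (f * g).

Definition same_Ass J J' : Prop := forall P, in_Ass J P <-> in_Ass J' P.

(* s is an S/J-regular sequence of elements of M.                             *)
Definition regular_seq M J s : Prop :=
  [/\ (forall f, f \in s -> M f),
      (forall i, (i < size s)%N -> forall g,
         ideal_adjoin J (take i s) (s`_i * g) -> ideal_adjoin J (take i s) g)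
    & ~ ideal_adjoin J s 1].

(* r is the maximal length of an S/J-regular sequence in M.                   *)
Definition is_grade M J (r : nat) : Prop :=
  (exists2 s, size s = r & regular_seq M J s) /\
  (forall s, regular_seq M J s -> (size s <= r)%N).

End Ideals.

Definition stable_from (E : nat -> nat -> Prop) (m : nat) : Prop :=
  (0 < m)%N /\ forall l, (m <= l)%N -> E m l.

Definition least_stable (E : nat -> nat -> Prop) (m : nat) : Prop :=
  stable_from E m /\ forall m', stable_from E m' -> (m <= m')%N.

Section Polynomials.
Variables (K : fieldType) (n : nat).
Implicit Types I J : {mpoly K[n]} -> Prop.

Definition max_ideal : {mpoly K[n]} -> Prop :=
  ideal_gen (fun f => exists i : 'I_n, f = 'X_i).

(* r = depth S/J, i.e. the grade of S/J in the graded maximal ideal.          *)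
Definition is_depth J (r : nat) : Prop := is_grade max_ideal J r.

Definition same_depth J J' : Prop := exists2 r, is_depth J r & is_depth J' r.

Definition is_astab I (m : nat) : Prop :=
  least_stable (fun a b => same_Ass (ideal_exp I a) (ideal_exp I b)) m.

Definition is_dstab I (m : nat) : Prop :=
  least_stable (fun a b => same_depth (ideal_exp I a) (ideal_exp I b)) m.

End Polynomials.

(* alpha, beta and b are indexed from 1; only the values alpha i, beta i with *)
(* 1 <= i <= k and b i with k < i <= n are ever used.                         *)
Record right_PLP_data (n k d : nat) (alpha beta b : nat -> nat) : Prop := {
  PLP_k : (1 <= k <= n - 1)%N;
  PLP_d : (0 < d)%N;
  PLP_alpha_beta : forall i, (1 <= i <= k)%N -> (alpha i <= beta i)%N;
  PLP_alpha_mono :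
    forall i j, (1 <= i)%N -> (i <= j)%N -> (j <= k)%N -> (alpha i <= alpha j)%N;
  PLP_alpha_d : (alpha k <= d)%N;
  PLP_beta_pos : (0 < beta 1)%N;
  PLP_beta_mono :
    forall i j, (1 <= i)%N -> (i <= j)%N -> (j <= k)%N -> (beta i <= beta j)%N;
  PLP_beta_d : (beta k <= d)%N;
  PLP_b_pos : forall i, (k < i <= n)%N -> (0 < b i)%N;
  PLP_d_le : (d <= beta k + \sum_(k.+1 <= i < n.+1) b i)%N
}.

(* The variable x_i of the mathematics is 'X_j with j = i - 1 : 'I_n.         *)
Definition right_PLP_exponent (n k d : nat) (alpha beta b : nat -> nat)
    (u : 'X_{1..n}) : Prop :=
  [/\ (forall i, (1 <= i <= k)%N ->
         (alpha i <= \sum_(j < n | (j < i)%N) u j <= beta i)%N),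
      (forall j : 'I_n, (k <= j)%N -> (u j <= b j.+1)%N)
    & mdeg u = d].

Definition right_PLP_ideal (K : fieldType) (n k d : nat)
    (alpha beta b : nat -> nat) : {mpoly K[n]} -> Prop :=
  ideal_gen (fun f => exists2 u : 'X_{1..n},
    right_PLP_exponent k d alpha beta b u & f = 'X_[u]).

(* Main.v *)
(* Powers of a PLP ideal are again PLP ideals, with all data multiplied by    *)
(* the exponent m.  Write N = n - k, and let                                  *)
(* Delta = beta_k + b_{k+1} + ... + b_n - d be the slack of the tail.         *)
(*                                                                            *)
(* Associated primes.  J : x^w = P_F for some monomial x^w exactly when F is  *)
(* either an interval of path variables satisfying strict inequalities that   *)
(* are homogeneous in the data, or an interval ending at k together with a    *)
(* nonempty set A of tail variables satisfying such inequalities and the      *)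
(* bound |A| <= Delta (+ 1 when the interval is empty).  Only this last bound *)
(* depends on m.                                                              *)
(*                                                                            *)
(* Depth.  depth S/J = n - 1 - C - D, where C counts the i < k with           *)
(* alpha_i < beta_i and D = min(N or N - 1, Delta), N - 1 being used when the *)
(* constraint at k is tight (and D = 0 when it is tight at d).  For >=, S/J   *)
(* has a filtration by quotients S/P_F with at most C + D + 1 variables in F, *)
(* and the first r elementary symmetric polynomials form a regular sequence   *)
(* on all S/P_F with |F| <= n - r.  For <=, a product over consecutive blocks *)
(* of variables is a nonzero Koszul class.                                    *)
(*                                                                            *)
(* Both invariants become stationary at the first m with m Delta >= N         *)
(* (or N - 1), unless Delta = 0 or the constraint at k is tight at d, when    *)
(* they are constant.                                                         *)
Require Import Defs.
From HB Require Import structures.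
From mathcomp Require Import all_boot all_order all_algebra.
From mathcomp Require Import mpoly.
From mathcomp Require Import zify ring.
From Stdlib Require Classical_Prop.

Set Implicit Arguments.
Unset Strict Implicit.
Unset Printing Implicit Defensive.

Import GRing.Theory.

(** * Regular sequences and ideals *)

(** A lattice point of the [m]-fold polytope splits into [m] lattice points of the polytope by
    rounding its prefix sums, so a positive power of the ideal is again an ideal of the same kind
    with all data multiplied by [m] ([base_ideal_exp]). Both invariants are therefore computed for
    one ideal and then followed under scaling.

    The depth is [plp_depth]. Branching on exponents filters the quotient by quotients by monomial
    primes with few generators ([plp_prime_filtered]), and elementary symmetric polynomials are
    regular on each of them ([esyms_regular]). Conversely, a generator in which single units can be
    moved within blocks of variables yields a Koszul class of low degree, which bounds every regular
    sequence ([regular_size_le], [plp_size_le]).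

    Membership of a monomial is a system of linear inequalities ([plp_up_ineq]). An associated prime
    arises where one of them fails by exactly one and each variable of the prime repairs it
    ([mon_assoc_type], [path_type_mon_assoc], [tail_type_mon_assoc]).

    Under scaling the depth depends on [m] only through a minimum of a constant and [m] times the
    slack, and the primes only through a bound of the same shape on their number of tail variables.
    The most demanding prime contains the whole tail, so both sequences become stationary exactly
    when [stable_power m] holds ([power_rank_stable], [assoc_stable_power]); [base_ideal_stability]
    takes the least such [m]. *)

Section IdealTheory.
Local Open Scope ring_scope.
Variable S : comNzRingType.
Implicit Types (G I J P : S -> Prop) (s : seq S) (f g x y : S).

Lemma ideal0 J : is_ideal J -> J 0. Proof. by case. Qed.
Lemma idealD J f g : is_ideal J -> J f -> J g -> J (f + g).
Proof. by case=> _ + _; apply. Qed.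
Lemma ideal_mull J c f : is_ideal J -> J f -> J (c * f).
Proof. by case=> _ _; apply. Qed.
Lemma ideal_mulr J c f : is_ideal J -> J f -> J (f * c).
Proof. by rewrite mulrC; apply: ideal_mull. Qed.
Lemma idealN J f : is_ideal J -> J f -> J (- f).
Proof. by move=> idJ Jf; rewrite -mulN1r; apply: ideal_mull. Qed.
Lemma idealB J f g : is_ideal J -> J f -> J g -> J (f - g).
Proof. by move=> idJ Jf Jg; apply: idealD => //; apply: idealN. Qed.
Lemma ideal_sum J (T : Type) (r : seq T) (p : pred T) (F : T -> S) :
  is_ideal J -> (forall i, p i -> J (F i)) -> J (\sum_(i <- r | p i) F i).
Proof.
by move=> idJ JF; apply: big_ind => //; [apply: ideal0 | move=> *; apply: idealD].
Qed.

Lemma eq_is_ideal J J' : (forall f, J f <-> J' f) -> is_ideal J -> is_ideal J'.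
Proof.
move=> e [J0 JD JM]; split; first exact/e.
  by move=> f g /e Jf /e Jg; apply/e/JD.
by move=> c f /e Jf; apply/e/JM.
Qed.

Lemma ideal_gen_ideal G : is_ideal (ideal_gen G).
Proof.
split.
- exists 0%N, (fun=> 0), (fun=> 0); split; first by case.
  by rewrite big_ord0.
- move=> _ _ [r [c [g [Gg ->]]]] [r' [c' [g' [Gg' ->]]]].
  exists (r + r')%N.
  exists (fun i => match split i with inl i => c i | inr i => c' i end).
  exists (fun i => match split i with inl i => g i | inr i => g' i end).
  split; first by move=> i; case: (split i).
  rewrite big_split_ord; congr (_ + _); apply: eq_bigr => i _.
    by rewrite -[lshift _ _]/(unsplit (inl i)) unsplitK.
  by rewrite -[rshift _ _]/(unsplit (inr i)) unsplitK.
- move=> a _ [r [c [g [Gg ->]]]]; exists r, (fun i => a * c i), g; split=> //.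
  by rewrite mulr_sumr; apply: eq_bigr => i _; rewrite mulrA.
Qed.

Lemma ideal_gen_mem G f : G f -> ideal_gen G f.
Proof.
by move=> Gf; exists 1%N, (fun=> 1), (fun=> f); rewrite big_ord1 mul1r.
Qed.

Lemma ideal_gen_sub G J :
  is_ideal J -> (forall g, G g -> J g) -> forall f, ideal_gen G f -> J f.
Proof.
move=> idJ GJ _ [r [c [g [Gg ->]]]]; apply: ideal_sum => // i _.
by apply: ideal_mull => //; apply: GJ.
Qed.

(** The ideal [J + (y)], with a single cofactor in place of a sum over generators; [ideal_adjoinE]
    relates its iterates to [ideal_adjoin]. *)
Definition ideal_add J y : S -> Prop := fun g => exists h, J (g - y * h).

Lemma ideal_add_ideal J y : is_ideal J -> is_ideal (ideal_add J y).
Proof.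
move=> idJ; split.
- by exists 0; rewrite mulr0 subr0; apply: ideal0.
- move=> f g [h Jh] [h' Jh']; exists (h + h').
  by rewrite mulrDr opprD addrACA; apply: idealD.
- move=> c f [h Jh]; exists (c * h).
  by rewrite mulrCA -mulrBr; apply: ideal_mull.
Qed.

Lemma ideal_addW J y f : J f -> ideal_add J y f.
Proof. by exists 0; rewrite mulr0 subr0. Qed.

Lemma ideal_add_gen J y f : is_ideal J -> ideal_add J y (y * f).
Proof. by move=> idJ; exists f; rewrite subrr; apply: ideal0. Qed.

Lemma eq_ideal_add J J' y :
  (forall f, J f <-> J' f) -> forall f, ideal_add J y f <-> ideal_add J' y f.
Proof. by move=> e f; split=> -[h /e]; exists h. Qed.

Lemma ideal_addC J x y f :
  ideal_add (ideal_add J x) y f <-> ideal_add (ideal_add J y) x f.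
Proof.
by split=> -[h [h' Jh]]; exists h', h; rewrite addrAC.
Qed.

Fixpoint ideal_adds J s : S -> Prop :=
  if s is y :: s' then ideal_adds (ideal_add J y) s' else J.

Lemma ideal_adds_ideal J s : is_ideal J -> is_ideal (ideal_adds J s).
Proof. by elim: s J => //= y s IH J idJ; apply: IH; apply: ideal_add_ideal. Qed.

Lemma eq_ideal_adds J J' s :
  (forall f, J f <-> J' f) -> forall f, ideal_adds J s f <-> ideal_adds J' s f.
Proof. by elim: s J J' => //= y s IH J J' e; apply: IH; apply: eq_ideal_add. Qed.

Lemma ideal_addsW J s f : J f -> ideal_adds J s f.
Proof. by elim: s J => //= y s IH J Jf; apply: IH; apply: ideal_addW. Qed.

Lemma ideal_adds_mem J s y f :
  is_ideal J -> y \in s -> ideal_adds J s (y * f).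
Proof.
elim: s J => //= z s IH J idJ; rewrite inE => /predU1P [->|ys].
  by apply: ideal_addsW; apply: ideal_add_gen.
by apply: IH => //; apply: ideal_add_ideal.
Qed.

Lemma ideal_adds_sub J J' s : is_ideal J' -> (forall f, J f -> J' f) ->
  (forall y, y \in s -> J' y) -> forall f, ideal_adds J s f -> J' f.
Proof.
elim: s J => /= [|y s IH] J idJ' sJ sJ' f; first exact: sJ.
apply: IH => // [g [h Jh]|z zs]; last by apply: sJ'; rewrite inE zs orbT.
rewrite -[g](subrK (y * h)); apply: idealD => //; first exact: sJ.
by apply: ideal_mulr => //; apply: sJ'; rewrite mem_head.
Qed.

Lemma ideal_adjoinE J s f : is_ideal J -> ideal_adjoin J s f <-> ideal_adds J s f.
Proof.
move=> idJ; split.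
  apply: ideal_gen_sub; first exact: ideal_adds_ideal.
  move=> g [Jg|gs]; first exact: ideal_addsW.
  by rewrite -[g]mulr1; apply: ideal_adds_mem.
apply: ideal_adds_sub; first exact: ideal_gen_ideal.
  by move=> g Jg; apply: ideal_gen_mem; left.
by move=> g gs; apply: ideal_gen_mem; right.
Qed.

(** Regular sequences without properness, so that the zero quotients met in filtrations are
    allowed. *)
Fixpoint weakly_regular s J : Prop :=
  if s is y :: s' then
    (forall g, J (y * g) -> J g) /\ weakly_regular s' (ideal_add J y)
  else True.

Lemma eq_weakly_regular s J J' :
  (forall f, J f <-> J' f) -> weakly_regular s J -> weakly_regular s J'.
Proof.
elim: s J J' => //= y s IH J J' e [regy regs]; split.
  by move=> g /e /regy /e.
by apply: IH regs; apply: eq_ideal_add.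
Qed.

Lemma weakly_regular_rcons s y J :
  weakly_regular (rcons s y) J <->
  weakly_regular s J /\ (forall g, ideal_adds J s (y * g) -> ideal_adds J s g).
Proof.
elim: s J => [|z s IH] J /=; first by split=> -[].
split; first by case=> ? /IH [? ?].
by case=> -[? ?] ?; split=> //; apply/IH.
Qed.

Lemma weakly_regularP s J : weakly_regular s J <->
  forall i, (i < size s)%N -> forall g,
    ideal_adds J (take i s) (s`_i * g) -> ideal_adds J (take i s) g.
Proof.
elim: s J => [|y s IH] J /=; first by [].
split=> [[regy /IH regs] [|i] //= lti g|reg]; first exact: regs.
split; first exact: (reg 0%N).
by apply/IH => i lti g; apply: (reg i.+1).
Qed.

Lemma regular_seqP M J s : is_ideal J -> regular_seq M J s <->
  [/\ forall f, f \in s -> M f, weakly_regular s J & ~ ideal_adds J s 1].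
Proof.
move=> idJ; split=> -[sM regs n1]; split=> //.
- apply/weakly_regularP => i lti g Jg.
  by apply/(ideal_adjoinE _ _ idJ)/regs => //; apply/(ideal_adjoinE _ _ idJ).
- by move/(ideal_adjoinE _ _ idJ).
- move=> i lti g /(ideal_adjoinE _ _ idJ) Jg; apply/(ideal_adjoinE _ _ idJ).
  by move/weakly_regularP: regs; apply.
- by move/(ideal_adjoinE _ _ idJ).
Qed.

(** Regularity passes from the ends to the middle of [0 -> S/(J:x) -> S/J -> S/(J+(x)) -> 0]. The
    sequence stays exact after adding [y] because [y] is regular on [S/(J+(x))], which makes
    [(J+(y)):x] equal to [(J:x)+(y)]. *)
Lemma weakly_regular_split s J x : is_ideal J ->
  weakly_regular s (fun g => J (x * g)) -> weakly_regular s (ideal_add J x) ->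
  weakly_regular s J.
Proof.
elim: s J => //= y s IH J idJ [regyc regsc] [regya regsa]; split.
  move=> g Jyg; have [|h Jgh] := regya g; first exact: ideal_addW.
  rewrite -[g](subrK (x * h)); apply: idealD => //; apply: regyc.
  rewrite mulrCA; have -> : y * (x * h) = y * g - y * (g - x * h) by ring.
  by apply: idealB => //; apply: ideal_mull.
apply: IH; first exact: ideal_add_ideal.
  apply: eq_weakly_regular regsc => f; split=> -[h Jh].
    by exists (x * h); rewrite mulrCA -mulrBr.
  have [|h' Jhh'] := regya h.
    exists f; have -> : y * h - x * f = - (x * f - y * h) by ring.
    exact: idealN.
  exists h'; rewrite mulrBr.
  have -> : x * f - x * (y * h') = (x * f - y * h) + y * (h - x * h') by ring.
  by apply: idealD => //; apply: ideal_mull.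
by apply: eq_weakly_regular regsa => f; apply: ideal_addC.
Qed.

End IdealTheory.

(** * Koszul cohomology *)

Section Koszul.
Local Open Scope ring_scope.
Variable S : comNzRingType.
Implicit Types (J : S -> Prop) (a b x : nat -> S).

(* The exterior algebra on k generators, as a module: a pair (u, v) of        *)
(* cochains on the first k generators stands for u + v e_k.                   *)
Fixpoint koszul (k : nat) : lmodType S :=
  if k is k'.+1 then (koszul k' * koszul k')%type : lmodType S else S^o.

Fixpoint wedge a k : koszul k -> koszul k :=
  if k is k'.+1 then fun c => (wedge a c.1, a k' *: c.1 - wedge a c.2)
  else fun=> 0.

Fixpoint contract a k : koszul k -> koszul k :=
  if k is k'.+1 then fun c => (contract a c.1 + a k' *: c.2, - contract a c.2)
  else fun=> 0.

Fixpoint kone k : koszul k := if k is k'.+1 then (kone k', 0) else 1.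

Fixpoint kconst k : koszul k -> S :=
  if k is k'.+1 then fun c => kconst c.1 else fun c => c.

(** Cochains that vanish in the Koszul complex of [S/J]. *)
Fixpoint kmem J k : koszul k -> Prop :=
  if k is k'.+1 then fun c => kmem J c.1 /\ kmem J c.2 else J.

Definition dotp k a b : S := \sum_(i < k) a i * b i.


Lemma kpairP k (u v : koszul k.+1) : u.1 = v.1 -> u.2 = v.2 -> u = v.
Proof. by case: u v => [? ?] [? ?] /= -> ->. Qed.
Lemma kfstD k (u v : koszul k.+1) : (u + v).1 = u.1 + v.1. Proof. by []. Qed.
Lemma ksndD k (u v : koszul k.+1) : (u + v).2 = u.2 + v.2. Proof. by []. Qed.
Lemma kfstZ k s (u : koszul k.+1) : (s *: u).1 = s *: u.1. Proof. by []. Qed.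
Lemma ksndZ k s (u : koszul k.+1) : (s *: u).2 = s *: u.2. Proof. by []. Qed.
Lemma kfstN k (u : koszul k.+1) : (- u).1 = - u.1. Proof. by []. Qed.
Lemma ksndN k (u : koszul k.+1) : (- u).2 = - u.2. Proof. by []. Qed.
Definition kE := (kfstD, ksndD, kfstZ, ksndZ, kfstN, ksndN).

Lemma wedge_linear a k : linear (@wedge a k).
Proof.
elim: k => [|k IH] s u v /=; first by rewrite scaler0 addr0.
apply: kpairP; rewrite !kE /= IH // scalerDr opprD scalerBr addrACA.
by rewrite !scalerA mulrC.
Qed.

Lemma contract_linear a k : linear (@contract a k).
Proof.
elim: k => [|k IH] s u v /=; first by rewrite scaler0 addr0.
apply: kpairP; rewrite !kE /= IH.
  by rewrite !scalerDr !scalerA [s * _]mulrC addrACA.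
by rewrite opprD scalerN.
Qed.

HB.instance Definition _ a k :=
  GRing.isLinear.Build S (koszul k) (koszul k) _ (@wedge a k) (@wedge_linear a k).
HB.instance Definition _ a k :=
  GRing.isLinear.Build S (koszul k) (koszul k) _ (@contract a k)
    (@contract_linear a k).

Lemma contract_wedge a b k (u : koszul k) :
  contract a (wedge b u) = dotp k a b *: u - wedge b (contract a u).
Proof.
rewrite /dotp; elim: k u => [|k IH] u /=.
  by rewrite big_ord0 scale0r subr0.
rewrite big_ord_recr /=; apply: kpairP; rewrite !kE /= ?linearB ?linearD ?linearZ /= IH.

  by rewrite scalerDl !scalerA [b k * _]mulrC addrACA.
rewrite [wedge b (- _)]linearN !scalerN !opprK scalerDl !scalerA [b k * _]mulrC.
rewrite [- _ - _ *: _]addrC -[X in _ = _ + X]addrA [RHS]addrA addrK.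
by rewrite addrCA.
Qed.

Lemma wedgeD a b k (u : koszul k) :
  wedge (fun i => a i + b i) u = wedge a u + wedge b u.
Proof.
elim: k u => [|k IH] u /=; first by rewrite addr0.
by apply: kpairP; rewrite !kE /= IH // scalerDl opprD addrACA.
Qed.

Lemma wedgeZ s a k (u : koszul k) :
  wedge (fun i => s * a i) u = s *: wedge a u.
Proof.
elim: k u => [|k IH] u /=; first by rewrite scaler0.
by apply: kpairP; rewrite !kE /= IH // scalerBr scalerA.
Qed.

Lemma eq_wedge a b k (u : koszul k) :
  (forall i, (i < k)%N -> a i = b i) -> wedge a u = wedge b u.
Proof.
elim: k u => //= k IH u e; rewrite e // !IH // => i lti; apply: e.
all: exact: ltnW.
Qed.

Lemma wedge0 k (u : koszul k) : wedge (fun=> 0) u = 0.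
Proof.
rewrite (@eq_wedge _ (fun i => 0 * (0 : S))) => [|i _]; last by rewrite mul0r.
by rewrite wedgeZ scale0r.
Qed.

Lemma wedge_anticomm a b k (u : koszul k) :
  wedge a (wedge b u) = - wedge b (wedge a u).
Proof.
elim: k u => [|k IH] u /=; first by rewrite oppr0.
apply: kpairP; rewrite !kE /=; first exact: IH.
rewrite [wedge a (_ - _)]linearB [wedge b (_ - _)]linearB !linearZ /= IH opprK.
by rewrite opprB opprD addrA addrAC.
Qed.

Lemma wedge_sq a k (u : koszul k) : wedge a (wedge a u) = 0.
Proof.
elim: k u => [|k IH] u //=.
apply: kpairP => /=; first exact: IH.
by rewrite linearB linearZ /= IH subr0 subrr.
Qed.

Lemma contract_one a k : contract a (kone k) = 0.
Proof. by elim: k => //= k ->; rewrite scaler0 addr0 linear0 oppr0. Qed.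

Lemma kconst_wedge a k (u : koszul k) : kconst (wedge a u) = 0.
Proof. by elim: k u => //= k IH u. Qed.

Lemma kconst_one k : kconst (kone k) = 1. Proof. by elim: k. Qed.

Lemma kconst_linear k : linear_for *%R (@kconst k).
Proof. by elim: k => //= k IH s u v; rewrite !kE IH. Qed.

HB.instance Definition _ k :=
  GRing.isLinear.Build S (koszul k) S _ (@kconst k) (@kconst_linear k).

Lemma kmemW J J' k (u : koszul k) :
  (forall f, J f -> J' f) -> kmem J u -> kmem J' u.
Proof.
move=> sJ; elim: k u => /= [|k IH] u; first exact: sJ.
by move=> [? ?]; split; apply: IH.
Qed.

Section Membership.
Variable J : S -> Prop.
Hypothesis idJ : is_ideal J.

Lemma kmemD k (u v : koszul k) : kmem J u -> kmem J v -> kmem J (u + v).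
Proof.
elim: k u v => /= [|k IH] u v; first exact: idealD.
by move=> [? ?] [? ?]; split; apply: IH.
Qed.

Lemma kmemZ k s (u : koszul k) : kmem J u -> kmem J (s *: u).
Proof.
elim: k u => /= [|k IH] u; first exact: ideal_mull.
by move=> [? ?]; split; apply: IH.
Qed.

Lemma kmemZl k s (u : koszul k) : J s -> kmem J (s *: u).
Proof.
move=> Js; elim: k u => /= [|k IH] u; first exact: ideal_mulr.
by split; apply: IH.
Qed.

Lemma kmemN k (u : koszul k) : kmem J u -> kmem J (- u).
Proof. by rewrite -scaleN1r; apply: kmemZ. Qed.

Lemma kmemB k (u v : koszul k) : kmem J u -> kmem J v -> kmem J (u - v).
Proof. by move=> Ju Jv; apply: kmemD => //; apply: kmemN. Qed.

Lemma kmem_wedge a k (u : koszul k) : kmem J u -> kmem J (wedge a u).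
Proof.
elim: k u => /= [|k IH] u; first by move=> _; apply: ideal0.
by move=> [? ?]; split; [|apply: kmemB; [apply: kmemZ|]]; try apply: IH.
Qed.

Lemma kmem_contract a k (u : koszul k) : kmem J u -> kmem J (contract a u).
Proof.
elim: k u => /= [|k IH] u; first by move=> _; apply: ideal0.
by move=> [? ?]; split; [apply: kmemD; [|apply: kmemZ]|apply: kmemN];
   try apply: IH.
Qed.

Lemma kmem_const k (u : koszul k) : kmem J u -> J (kconst u).
Proof. by elim: k u => //= k IH u [/IH]. Qed.

Lemma kmem_regular k y (u : koszul k) :
  (forall g, J (y * g) -> J g) -> kmem J (y *: u) -> kmem J u.
Proof.
move=> reg; elim: k u => /= [|k IH] u; first exact: reg.
by move=> [? ?]; split; apply: IH.
Qed.

Lemma kmem_ideal_add k y (u : koszul k) :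
  kmem (ideal_add J y) u -> exists v, kmem J (u - y *: v).
Proof.
elim: k u => /= [|k IH] u; first by [].
by move=> [/IH [v Jv] /IH [v' Jv']]; exists (v, v').
Qed.

End Membership.

(* Being killed by any d + 1 contractions means having degree at most d.      *)
Fixpoint kdeg_le (d k : nat) (c : koszul k) : Prop :=
  if d is d'.+1 then forall a, kdeg_le d' (contract a c)
  else forall a, contract a c = 0.

Lemma kdeg_leD d k (u v : koszul k) :
  kdeg_le d u -> kdeg_le d v -> kdeg_le d (u + v).
Proof.
elim: d u v => /= [|d IH] u v du dv a; rewrite linearD /=.
  by rewrite du dv addr0.
exact: IH.
Qed.

Lemma kdeg_leZ d k s (u : koszul k) : kdeg_le d u -> kdeg_le d (s *: u).
Proof.
elim: d u => /= [|d IH] u du a; rewrite linearZ /= ?du ?scaler0 //.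
exact: IH.
Qed.

Lemma kdeg_le_wedge d k a (u : koszul k) :
  kdeg_le d u -> kdeg_le d.+1 (wedge a u).
Proof.
elim: d u => [|d IH] u du b; rewrite contract_wedge.
  by move=> a'; rewrite du linear0 subr0 linearZ /= du scaler0.
rewrite -scaleN1r; apply: (@kdeg_leD d.+1); first exact: (@kdeg_leZ d.+1).
by apply: (@kdeg_leZ d.+1); apply: IH.
Qed.

(* Contracting with the coefficients of y in terms of the x_i is a homotopy   *)
(* for multiplication by y.                                                   *)
Lemma regular_koszul_exact k x ys J d (c : koszul k) : is_ideal J ->
  (forall y, y \in ys -> exists a, y = dotp k a x) ->
  weakly_regular ys J -> (d < size ys)%N -> kdeg_le d c ->
  kmem J (wedge x c) -> exists g, kmem J (c - wedge x g).
Proof.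
elim: ys J d c => //= y ys IH J d c idJ ysx [regy regys] ltd dc Jdc.
have [a ya] : exists a, y = dotp k a x by apply: ysx; rewrite mem_head.
have yc : y *: c = contract a (wedge x c) + wedge x (contract a c).
  by rewrite contract_wedge ya subrK.
have Jh : kmem J (contract a (wedge x c)) by apply: kmem_contract.
case: d ltd dc => [|d] ltd dc.
  exists 0; rewrite linear0 subr0; apply: (kmem_regular regy).
  by rewrite yc dc linear0 addr0.
have idJ' := @ideal_add_ideal _ J y idJ.
have [||||||f Jf] := IH (ideal_add J y) d (contract a c); rewrite //.
- by move=> z zys; apply: ysx; rewrite inE zys orbT.
- have -> : wedge x (contract a c) = y *: c - contract a (wedge x c).
    by rewrite yc addrAC subrr add0r.
  apply: kmemB => //.
    by apply: kmemZl => //; have := ideal_add_gen y 1 idJ; rewrite mulr1.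
  by apply: kmemW Jh => f; apply: ideal_addW.
(* Modulo [J], [contract a c] is [wedge x f + y *: g]. Applying [wedge x] kills the first term, so
   [y *: (c - wedge x g)] has coefficients in [J], and [y] cancels. *)
have [g Jg] := kmem_ideal_add Jf; exists g.
apply: (kmem_regular regy).
have Jg' := kmem_wedge idJ x Jg.
rewrite !linearB linearZ /= wedge_sq subr0 in Jg'.
have -> : y *: (c - wedge x g) =
    contract a (wedge x c) + (wedge x (contract a c) - y *: wedge x g).
  by rewrite scalerBr yc addrA.
exact: kmemD.
Qed.

(** * Products of linear forms that are not coboundaries *)

Section Nonvanishing.
Variables (J : S -> Prop) (k : nat) (x : nat -> S) (G : nat -> nat -> S).
Hypothesis idJ : is_ideal J.

Definition kprod (s : seq nat) : koszul k := foldr (fun i => @wedge (G i) k) (kone k) s.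

Lemma kdeg_le_prod s : kdeg_le (size s) (kprod s).
Proof.
elim: s => [|i s IH] /=; first by move=> a; rewrite contract_one.
by have := kdeg_le_wedge (G i) IH.
Qed.

Lemma wedge_prod_mem s i : i \in s -> wedge (G i) (kprod s) = 0.
Proof.
elim: s => //= j s IH; rewrite inE; case: eqP => [-> _|_ /= /IH e].
  exact: wedge_sq.
by rewrite wedge_anticomm e linear0 oppr0.
Qed.

Lemma wedge_kmem a (u : koszul k) :
  (forall i, (i < k)%N -> kmem J (a i *: u)) -> kmem J (wedge a u).
Proof.
elim: (k) u => /= [|k' IH] u H; first by move=> *; apply: ideal0.
split; first by apply: IH => i lti; case: (H i (ltnW lti)).
apply: kmemB => //; first by case: (H k' (ltnSn _)).
by apply: IH => i lti; case: (H i (ltnW lti)).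
Qed.

(** The coefficients of a wedge product are signed sums of products taking one coefficient from each
    form. *)
Lemma kprod_kmem s m : uniq s ->
  (forall a : nat -> nat, (forall i, a i < k)%N ->
     J (m * \prod_(i <- s) G i (a i))) ->
  (0 < k)%N -> kmem J (m *: kprod s).
Proof.
move=> + + k_gt0; elim: s m => /= [|i s IH] m us H.
  apply: kmemZl => //; have := H (fun=> 0%N) (fun=> k_gt0).
  by rewrite big_nil mulr1.
case/andP: us => nis us.
rewrite -linearZ /=; apply: wedge_kmem => v ltv; rewrite scalerA.
apply: IH => // a lta.
have := H (fun j => if j == i then v else a j).
rewrite big_cons eqxx mulrA [m * _]mulrC.
rewrite (@eq_big_seq _ _ _ _ _ _ (fun j => G j (a j))) => [|j js].
  by apply=> j; case: ifP.
by rewrite (_ : (j == i) = false) //; apply: contraNF nis => /eqP <-.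
Qed.

(** The pairing matrix of the [v i] with the [G j] is diagonal, so its determinant is the product of
    the diagonal. *)
Lemma contract_prod v s : uniq s ->
  (forall i j, i \in s -> j \in s -> dotp k (v i) (G j) = if i == j then dotp k (v i) (G i) else 0) ->
  foldl (fun u i => contract (v i) u) (kprod s) s =
    (\prod_(i <- s) dotp k (v i) (G i)) *: kone k.
Proof.
elim: s => [|i s IH] /=; first by rewrite big_nil scale1r.
case/andP=> nis us H; rewrite contract_wedge big_cons.
have -> : contract (v i) (kprod s) = 0.
  have : forall j, j \in s -> dotp k (v i) (G j) = 0.
    move=> j js; rewrite H ?mem_head ?inE ?js ?orbT //.
    by case: eqP nis => // ->; rewrite js.
  elim: (s) => [|j s' IHs] z /=; first by rewrite contract_one.
  rewrite contract_wedge z ?mem_head // scale0r IHs => [|j' js'].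
    by rewrite linear0 subrr.
  by apply: z; rewrite inE js' orbT.
rewrite linear0 subr0 -scalerA -IH //; last first.
  by move=> ? ? js js'; apply: H; rewrite inE ?js ?js' orbT.
elim: (s) (kprod s) => //= j s' IHs u; rewrite linearZ /=; exact: IHs.
Qed.

(** Moving the contractions across [wedge x] produces multiples [dotp k (v i) x * f] with [f] in
    [J]; the remaining term still starts with [wedge x] and has no constant part. [Q] stands for a
    condition such as the vanishing of one coefficient. *)
Lemma kconst_contract_wedge (Q : S -> Prop) (v : nat -> nat -> S) (s : seq nat)
    (u : koszul k) :
  Q 0 -> (forall f g, Q f -> Q g -> Q (f - g)) ->
  (forall i f, i \in s -> J f -> Q (dotp k (v i) x * f)) -> kmem J u ->
  Q (kconst (foldl (fun u i => contract (v i) u) (wedge x u) s)).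
Proof.
move=> Q0 QB; elim: s u => [|i s IH] u QM Ju /=; first by rewrite kconst_wedge.
rewrite contract_wedge.
have -> : forall u' w' : koszul k, foldl (fun u i => contract (v i) u) (u' - w') s =
    foldl (fun u i => contract (v i) u) u' s -
    foldl (fun u i => contract (v i) u) w' s.
  by elim: (s) => //= j s' IHs u' w'; rewrite linearB; apply: IHs.
rewrite linearB; apply: QB; last first.
  apply: IH; last exact: kmem_contract.
  by move=> j f js; apply: QM; rewrite inE js orbT.
have -> : forall (y : S) (w : koszul k),
    foldl (fun u i => contract (v i) u) (y *: w) s =
    y *: foldl (fun u i => contract (v i) u) w s.
  by elim: (s) => //= j s' IHs y w; rewrite linearZ; apply: IHs.
rewrite linearZ /=; apply: QM; first exact: mem_head.
apply: kmem_const.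
elim: (s) (u) Ju => //= j s' IHs w Jw; apply: IHs; exact: kmem_contract.
Qed.

(* The wedge product of the blocks in js is a cocycle modulo J, as the        *)
(* missing block i0 completes it to an element of J; contracting with the v_i *)
(* shows that it is not a coboundary.                                         *)
Lemma regular_size_le i0 js m (f : nat -> S) (v : nat -> nat -> S) (Q : S -> Prop) ys :
  (0 < k)%N -> uniq (i0 :: js) ->
  (forall i, (i < k)%N -> x i = G i0 i + \sum_(j <- js) f j * G j i) ->
  (forall a : nat -> nat, (forall i, a i < k)%N ->
     J (m * \prod_(i <- i0 :: js) G i (a i))) ->
  (forall i j, i \in i0 :: js -> j \in i0 :: js ->
     dotp k (v i) (G j) = if i == j then dotp k (v i) (G i) else 0) ->
  Q 0 -> (forall f g, Q f -> Q g -> Q (f - g)) ->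
  (forall i g, i \in i0 :: js -> J g -> Q (dotp k (v i) x * g)) ->
  ~ Q (m * \prod_(i <- i0 :: js) dotp k (v i) (G i)) ->
  (forall y, y \in ys -> exists a, y = dotp k a x) ->
  weakly_regular ys J -> (size ys <= size js)%N.
Proof.
move=> k_gt0 ujs xG Jm vG Q0 QB QM nQ ysx regys; rewrite leqNgt; apply/negP => ltr.
pose c := m *: kprod js.
have dc : wedge x c = m *: kprod (i0 :: js).
  rewrite linearZ /=; congr (_ *: _).
  rewrite (eq_wedge _ xG) wedgeD -[RHS]addr0; congr (_ + _).
  have : {subset js <= js} by [].
  elim: {1 3}js => [|j s IH] ss.
    rewrite (@eq_wedge _ (fun=> 0)) ?wedge0 // => i _; exact: big_nil.
  rewrite (@eq_wedge _ (fun i => f j * G j i + \sum_(j <- s) f j * G j i)).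
    rewrite wedgeD wedgeZ wedge_prod_mem ?scaler0 ?add0r; last by apply: ss; rewrite mem_head.
    by apply: IH => i si; apply: ss; rewrite inE si orbT.
  by move=> i _; rewrite big_cons.
have [||g Jg] := @regular_koszul_exact k x ys J (size js) c idJ ysx regys ltr.
- by apply: kdeg_leZ; apply: kdeg_le_prod.
- by rewrite dc; apply: kprod_kmem.
(* The cochain [c - wedge x g] has coefficients in [J] and the same image under [wedge x] as [c],
   namely [m] times the full product. *)
apply: nQ; have := kconst_contract_wedge Q0 QB QM Jg.
have -> : wedge x (c - wedge x g) = m *: kprod (i0 :: js).
  by rewrite linearB /= wedge_sq subr0 dc.
have -> : forall s (y : S) (w : koszul k),
    foldl (fun u i => contract (v i) u) (y *: w) s =
    y *: foldl (fun u i => contract (v i) u) w s.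
  by elim=> //= j s' IHs y w; rewrite linearZ; apply: IHs.
by rewrite contract_prod // !linearZ /= kconst_one mulr1.
Qed.

End Nonvanishing.

End Koszul.

(** * Monomial ideals and their associated primes *)

Section MonomialIdeals.
Local Open Scope ring_scope.
Variables (K : fieldType) (n : nat).
Implicit Types (U : pred 'X_{1..n}) (f g : {mpoly K[n]}) (w m : 'X_{1..n}).
Implicit Types (F : {set 'I_n}) (v : 'I_n).

Definition upclosed U := forall m m', U m -> (m <= m')%MM -> U m'.

Definition monideal U : {mpoly K[n]} -> Prop :=
  fun f => forall m, m \in msupp f -> U m.

Definition mpart (p : pred 'X_{1..n}) f : {mpoly K[n]} :=
  \sum_(m <- msupp f | p m) f@_m *: 'X_[m].

Lemma mcoeff_part p f m : (mpart p f)@_m = if p m then f@_m else 0.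
Proof.
rewrite /mpart raddf_sum /=.
have E m' : (f@_m' *: 'X_[m'])@_m = if m' == m then f@_m else 0.
  by rewrite mcoeffZ mcoeffX; case: eqP => [->|]; rewrite ?mulr1 ?mulr0.
case: (boolP (m \in msupp f)) => mf; last first.
  rewrite big1 ?(memN_msupp_eq0 mf) ?if_same // => m' _.
  by rewrite E (memN_msupp_eq0 mf) if_same.
rewrite big_mkcond (bigD1_seq m) ?msupp_uniq //= E eqxx big1 ?addr0 // => m'.
by move=> nm'; case: ifP => // _; rewrite E (negbTE nm').
Qed.

Lemma msupp_part p f m : (m \in msupp (mpart p f)) = p m && (m \in msupp f).
Proof.
by rewrite !mcoeff_msupp mcoeff_part; case: (p m); rewrite ?eqxx.
Qed.

Lemma mpart_split p f : f = mpart p f + mpart (predC p) f.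
Proof.
apply/mpolyP => m; rewrite mcoeffD !mcoeff_part /=.
by case: (p m); rewrite ?addr0 ?add0r.
Qed.

Lemma monidealX U m : monideal U 'X_[m] <-> U m.
Proof.
split=> [|Um m'] ; first by apply; rewrite msuppX mem_head.
by rewrite msuppX inE => /eqP ->.
Qed.

Lemma monideal_ideal U : upclosed U -> is_ideal (monideal U).
Proof.
move=> upU; split.
- by move=> m; rewrite msupp0.
- move=> f g Jf Jg m /msuppD_le; rewrite mem_cat => /orP[/Jf|/Jg] //.
- move=> c f Jf m /msuppM_le /allpairsP [[m1 m2] /= [m1c /Jf Um2 ->]].
  by apply: upU Um2 _; apply: lem_addl.
Qed.

Lemma monideal_part U f : monideal U (mpart U f).
Proof. by move=> m; rewrite msupp_part => /andP[]. Qed.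

Lemma eq_monideal U U' : U =1 U' -> forall f, monideal U f <-> monideal U' f.
Proof. by move=> e f; split=> Jf m /Jf; rewrite e. Qed.

Lemma mem_msuppMX f m m' : (m' + m \in msupp (f * 'X_[m]))%MM = (m' \in msupp f).
Proof. by rewrite !mcoeff_msupp addmC mcoeffMX. Qed.

Lemma monidealMX U f m :
  monideal U (f * 'X_[m]) <-> monideal (fun m' => U (m' + m)%MM) f.
Proof.
split=> [JfX m' m'f|Jf m']; first by apply: JfX; rewrite mem_msuppMX.
rewrite (perm_mem (msuppMX _ _)) => /mapP [m1 m1f ->].
by rewrite addmC; apply: Jf.
Qed.

Lemma ideal_mpoly (J : {mpoly K[n]} -> Prop) f : is_ideal J ->
  (forall m, m \in msupp f -> J 'X_[m]) -> J f.
Proof.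
move=> idJ Jm; rewrite [f]mpolyE big_seq; apply: ideal_sum => // m /Jm Jm'.
by rewrite -mul_mpolyC; apply: ideal_mull.
Qed.

Lemma monideal_addX U (v : 'I_n) f : upclosed U ->
  ideal_add (monideal U) 'X_v f <-> monideal (fun m => U m || (0 < m v)%N) f.
Proof.
move=> upU; split.
  case=> h Jfh m mf; case: (boolP (m \in msupp ('X_v * h))) => mh.
    move: mh; rewrite mulrC (perm_mem (msuppMX _ _)) => /mapP [m' _ ->].
    by rewrite mnmDE mnm1E eqxx orbT.
  apply/orP; left; apply: Jfh; rewrite mcoeff_msupp mcoeffB.
  by rewrite (memN_msupp_eq0 mh) subr0 -mcoeff_msupp.
have idJ := ideal_add_ideal 'X_v (monideal_ideal upU).
move=> Jf; apply: ideal_mpoly => // m /Jf /orP[Um|mv].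
  by apply: ideal_addW; apply/monidealX.
have -> : m = (U_(v) + (m - U_(v)))%MM.
  by rewrite addmC submK // lep1mP -lt0n.
by rewrite mpolyXD; apply: ideal_add_gen; apply: monideal_ideal.
Qed.

(** [monideal (meets F)] is the monomial prime P_F generated by the variables in [F]. *)
Definition meets (F : {set 'I_n}) : pred 'X_{1..n} :=
  fun m => [exists v in F, (0 < m v)%N].

Lemma meetsP F m : reflect (exists2 v, v \in F & (0 < m v)%N) (meets F m).
Proof. exact: exists_inP. Qed.

Lemma meets_upclosed F : upclosed (meets F).
Proof.
move=> m m' /meetsP [v vF mv] /mnm_lepP le; apply/meetsP; exists v => //.
exact: leq_trans (le v).
Qed.

Lemma meetsD F m m' : meets F (m + m')%MM = meets F m || meets F m'.
Proof.
apply/meetsP/orP => [[v vF]|[] /meetsP [v vF mv]].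
- by rewrite mnmDE addn_gt0 => /orP[mv|mv]; [left|right]; apply/meetsP; exists v.
- by exists v => //; rewrite mnmDE addn_gt0 mv.
- by exists v => //; rewrite mnmDE addn_gt0 mv orbT.
Qed.

Lemma meets0 F : meets F 0%MM = false.
Proof. by apply/meetsP => -[v _]; rewrite mnm0E. Qed.

(** Modulo P_F a polynomial equals its part free of the variables in [F], and the leading exponent
    of a product of two nonzero such parts again avoids [F]. *)
Lemma meets_prime F : is_prime_ideal (monideal (meets F)).
Proof.
have idP := monideal_ideal (@meets_upclosed F).
split=> // [P1|f g Pfg].
  by have := P1 0%MM; rewrite msupp1 mem_head meets0 => /(_ isT).
pose q := predC (meets F).
have Pp h : monideal (meets F) h <-> mpart q h = 0.
  split=> [Ph|q0].
    apply/mpolyP => m; rewrite mcoeff_part mcoeff0 /q /=.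
    case: (boolP (m \in msupp h)) => mh; first by rewrite Ph.
    by rewrite (memN_msupp_eq0 mh) if_same.
  rewrite [h](mpart_split (meets F)) -/q q0 addr0; exact: monideal_part.
case: (eqVneq (mpart q f) 0) => [/Pp|f0]; first by left.
case: (eqVneq (mpart q g) 0) => [/Pp|g0]; first by right.
have Pqq : monideal (meets F) (mpart q f * mpart q g).
  have -> : mpart q f * mpart q g =
      f * g - mpart (meets F) f * g - mpart q f * mpart (meets F) g.
    have qE h : mpart q h = h - mpart (meets F) h.
      by apply/eqP; rewrite eq_sym subr_eq addrC -mpart_split.
    by rewrite !qE; ring.
  have Pp' h : monideal (meets F) (mpart (meets F) h) by apply: monideal_part.
  apply: (idealB idP); last exact: (ideal_mull _ idP (Pp' g)).
  exact: (idealB idP Pfg (ideal_mulr _ idP (Pp' f))).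
have fg0 : mpart q f * mpart q g != 0 by rewrite mulf_neq0.
have := Pqq _ (mlead_supp fg0); rewrite mleadM // meetsD.
have := mlead_supp f0; have := mlead_supp g0; rewrite !msupp_part /q /=.
by move=> /andP[/negbTE-> _] /andP[/negbTE-> _].
Qed.

(* P_F is the annihilator of the monomial x^w in S/J.                         *)
Definition mon_assoc U (F : {set 'I_n}) := exists w : 'X_{1..n},
  [/\ ~~ U w, forall v, v \in F -> U (w + U_(v))%MM
    & forall w', ~~ meets F w' -> ~~ U (w + w')%MM].

Lemma eq_in_Ass (J J' P P' : {mpoly K[n]} -> Prop) :
  (forall f, J f <-> J' f) -> (forall f, P f <-> P' f) ->
  in_Ass J P -> in_Ass J' P'.
Proof.
move=> eJ eP [[idP nP1 primeP] [g Pg]]; split; last first.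
  by exists g => f; rewrite -eP -eJ.
split; first exact: eq_is_ideal idP.
  by move/eP.
by move=> f h /eP /primeP [] /eP; [left|right].
Qed.

Lemma mon_assoc_Ass U F : upclosed U -> mon_assoc U F ->
  in_Ass (monideal U) (monideal (meets F)).
Proof.
move=> upU [w [nUw UF nU]]; split; first exact: meets_prime.
exists 'X_[w] => f; rewrite monidealMX; split=> Pf m mf.
  have /meetsP [v vF mv] := Pf m mf.
  apply: upU (UF v vF) _; apply/mnm_lepP => j; rewrite !mnmDE mnm1E addnC.
  by rewrite leq_add2r; case: eqP => // <-.
by apply: contraT => /nU; rewrite addmC Pf.
Qed.

Lemma meets_inj F F' :
  (forall f, monideal (meets F) f <-> monideal (meets F') f) -> F = F'.
Proof.
move=> e; apply/setP => v.
have E G : monideal (meets G) 'X_v <-> v \in G.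
  rewrite monidealX; split=> [/meetsP [j jG]|vG]; last first.
    by apply/meetsP; exists v => //; rewrite mnm1E eqxx.
  by rewrite mnm1E; case: eqP => // ->.
by apply/idP/idP => /E /e /E.
Qed.

Lemma prime_monomial (P : {mpoly K[n]} -> Prop) m : is_prime_ideal P ->
  P 'X_[m] -> exists2 v : 'I_n, P 'X_v & (0 < m v)%N.
Proof.
case=> idP nP1 primeP; rewrite mpolyXE_id.
elim: (index_enum _) => [|v s IH]; first by rewrite big_nil => /nP1.
rewrite big_cons => /primeP [|/IH //].
case: (posnP (m v)) => [->|mv]; first by rewrite expr0 => /nP1.
move=> Pv; exists v => //; elim: (m v) Pv => [|e IHe]; first by rewrite expr0 => /nP1.
by rewrite exprS => /primeP [].
Qed.

(* Multiplying g by a high power of the variables outside P leaves P = (J:g)  *)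
(* unchanged, and then any monomial of g outside J is a witness.              *)
Lemma Ass_mon_assoc U D (P : {mpoly K[n]} -> Prop) : upclosed U ->
  (forall m m', U m -> (forall v, minn (m v) D <= m' v)%N -> U m') ->
  in_Ass (monideal U) P ->
  exists2 F, mon_assoc U F & forall f, P f <-> monideal (meets F) f.
Proof.
move=> upU bdU [primeP [g Pg]]; have [idP nP1 prP] := primeP.
have idJ := monideal_ideal upU.
have [F PF] : exists F : {set 'I_n}, forall v, v \in F <-> P 'X_v.
  suff H (s : seq 'I_n) : exists F : {set 'I_n}, forall v, v \in s -> (v \in F <-> P 'X_v).
    by have [F HF] := H (enum 'I_n); exists F => v; apply: HF; rewrite mem_enum.
  elim: s => [|v s [F IH]]; first by exists set0.
  have [Pv|nPv] := Classical_Prop.classic (P 'X_v).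
    exists (v |: F) => v'; rewrite inE in_setU1.
    by case: eqP => [->|_ /= /IH].
  exists (F :\ v) => v'; rewrite inE in_setD1.
  by case: eqP => [->|_ /= /IH].
(* By [bdU] exponents above [D] do not influence membership, so the power [D] already saturates in
   the variables outside [F]. *)
pose h : 'X_{1..n} := [multinom if v \in F then 0%N else D | v < n].
pose g1 := mpart (predC U) (g * 'X_[h]).
have nPh : ~ P 'X_[h].
  by case/(prime_monomial primeP) => v /PF vF; rewrite mnmE vF.
have Pg1 f : P f <-> monideal U (f * g1).
  have -> : P f <-> P (f * 'X_[h]).
    by split=> [Pf|/prP[]//]; apply: ideal_mulr.
  rewrite Pg -mulrA ['X_[h] * g]mulrC {1}[g * _](mpart_split U) -/g1 mulrDr.
  have Jp : monideal U (f * mpart U (g * 'X_[h])).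
    exact: (ideal_mull f idJ (@monideal_part U _)).
  split=> [Jfg|Jfg]; last exact: (idealD idJ Jp Jfg).
  by have := idealB idJ Jfg Jp; rewrite addrAC subrr add0r.
have g1n0 : g1 != 0.
  by apply/eqP => g10; apply: nP1; apply/Pg1; rewrite g10 mulr0; apply: ideal0.
have g1P w : w \in msupp g1 -> [/\ ~~ U w, forall v, v \in F -> U (w + U_(v))%MM
    & forall w', ~~ meets F w' -> ~~ U (w + w')%MM].
  move=> wg1; have := wg1; rewrite msupp_part => /andP[/= nUw].
  rewrite (perm_mem (msuppMX _ _)) => /mapP [w0 _ ew].
  split=> // [v /PF /Pg1|w' nw'].
    by rewrite mulrC => /monidealMX; apply.
  apply: contra nUw => Uw; apply: bdU Uw _ => v.
  case: (boolP (v \in F)) => vF.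
    have : w' v = 0%N.
      apply/eqP; rewrite eqn0Ngt; apply: contra nw' => w'v.
      by apply/meetsP; exists v.
    by rewrite mnmDE => ->; rewrite addn0 geq_minl.
  apply: leq_trans (geq_minr _ _) _.
  by rewrite ew mnmDE mnmE (negbTE vF) leq_addr.
have [nUw UF nU] := g1P _ (mlead_supp g1n0).
exists F; first by exists (mlead g1).
have PmF f : monideal (meets F) f -> P f.
  move=> Ff; apply: ideal_mpoly => // m /Ff /meetsP [v /PF Pv mv].
  have -> : m = (U_(v) + (m - U_(v)))%MM.
    by rewrite addmC submK // lep1mP -lt0n.
  by rewrite mpolyXD; apply: ideal_mulr.
move=> f; split=> [Pf|]; last exact: PmF.
pose f0 := mpart (predC (meets F)) f.
have Pf0 : P f0.
  have -> : f0 = f - mpart (meets F) f.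
    by apply/eqP; rewrite eq_sym subr_eq addrC -mpart_split.
  by apply: idealB => //; apply: PmF; apply: monideal_part.
case: (eqVneq f0 0) => [f00|f0n0].
  by rewrite [f](mpart_split (meets F)) -/f0 f00 addr0; apply: monideal_part.
have /Pg1 Jf0 := Pf0; have f0g1 : f0 * g1 != 0 by rewrite mulf_neq0.
have := Jf0 _ (mlead_supp f0g1); rewrite mleadM // addmC => Uw.
have := mlead_supp f0n0; rewrite msupp_part => /andP[/nU].
by rewrite Uw.
Qed.

End MonomialIdeals.

(** * Elementary symmetric polynomials as regular sequences *)

Section SymmetricSequences.
Local Open Scope ring_scope.
Variables (K : fieldType) (n : nat).
Implicit Types (U : pred 'X_{1..n}) (f g h y : {mpoly K[n]}) (w m : 'X_{1..n}).
Implicit Types (p : pred 'X_{1..n}) (F : {set 'I_n}) (v : 'I_n) (Q : {mpoly K[n]} -> Prop).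

Lemma mpartB p f g : mpart p (f - g) = mpart p f - mpart p g.
Proof.
apply/mpolyP => m; rewrite mcoeffB !mcoeff_part mcoeffB.
by case: ifP; rewrite ?subr0.
Qed.

Lemma mpart_id p f : {in msupp f, forall m, p m} -> mpart p f = f.
Proof.
move=> pf; apply/mpolyP => m; rewrite mcoeff_part; case: ifP => // npm.
by apply/esym/memN_msupp_eq0; apply: contraFN npm; apply: pf.
Qed.

Lemma mpart_eq0 p f : {in msupp f, forall m, ~~ p m} -> mpart p f = 0.
Proof.
move=> pf; apply/mpolyP => m; rewrite mcoeff_part mcoeff0; case: ifP => // pm.
by apply/memN_msupp_eq0; apply: contraL pm; apply: pf.
Qed.

Definition homogeneous d y := forall m, m \in msupp y -> mdeg m = d.

Definition graded Q := forall f N, Q f -> Q (mpart (fun m => (mdeg m < N)%N) f).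

Lemma mpart_homogeneous d y h N : homogeneous d y ->
  mpart (fun m => (mdeg m < N)%N) (y * h) =
  y * mpart (fun m => (d + mdeg m < N)%N) h.
Proof.
move=> hy; pose p m := (d + mdeg m < N)%N.
have degM m : m \in msupp (y * mpart p h) -> (mdeg m < N)%N.
  move=> /msuppM_le /allpairsP [[m1 m2] /= [/hy m1d + ->]].
  by rewrite msupp_part mdegD m1d => /andP[].
have degM' m : m \in msupp (y * mpart (predC p) h) -> ~~ (mdeg m < N)%N.
  move=> /msuppM_le /allpairsP [[m1 m2] /= [/hy m1d + ->]].
  by rewrite msupp_part mdegD m1d => /andP[].
rewrite -[in RHS](mpart_id degM).
have -> : y * mpart p h = y * h - y * mpart (predC p) h.
  by apply/eqP; rewrite eq_sym subr_eq -mulrDr -mpart_split.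
by rewrite mpartB (mpart_eq0 degM') subr0.
Qed.

Lemma graded_add Q d y : graded Q -> homogeneous d y -> graded (ideal_add Q y).
Proof.
move=> gQ hy f N [h Qh]; exists (mpart (fun m => (d + mdeg m < N)%N) h).
by rewrite -mpart_homogeneous // -mpartB; apply: gQ.
Qed.

Lemma graded_monideal U : graded (monideal U).
Proof. by move=> f N Uf m; rewrite msupp_part => /andP[_ /Uf]. Qed.

(* A zero divisor g of y is divisible by every power of X_v modulo Q, hence   *)
(* belongs to Q for degree reasons.                                           *)
Lemma regular_exchange Q v d y : is_ideal Q -> graded Q -> homogeneous d y ->
  (forall g, Q ('X_v * g) -> Q g) ->
  (forall g, ideal_add Q 'X_v (y * g) -> ideal_add Q 'X_v g) ->
  (forall g, Q (y * g) -> Q g) /\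
  (forall g, ideal_add Q y ('X_v * g) -> ideal_add Q y g).
Proof.
move=> idQ gQ hy regx regy; set x : {mpoly K[n]} := 'X_v in regx regy *.
split=> [g Qyg|g [f Qf]]; last first.
  have [|f' Qf'] := regy f.
    by exists g; have := idealN idQ Qf; rewrite opprB.
  exists f'; apply: regx.
  have -> : x * (g - y * f') = (x * g - y * f) + y * (f - x * f') by ring.
  by apply: idealD => //; apply: ideal_mull.
have divx N : exists g', Q (g - x ^+ N * g') /\ Q (y * g').
  elim: N => [|N [g' [Qg' Qyg']]].
    by exists g; rewrite expr0 mul1r subrr; split=> //; apply: ideal0.
  have [g'' Qg''] := regy _ (ideal_addW x Qyg').
  exists g''; split.
    have -> : g - x ^+ N.+1 * g'' = (g - x ^+ N * g') + x ^+ N * (g' - x * g'').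
      by rewrite exprS; ring.
    by apply: idealD => //; apply: ideal_mull.
  apply: regx.
  have -> : x * (y * g'') = y * g' - y * (g' - x * g'') by ring.
  by apply: idealB => //; apply: ideal_mull.
(* Truncation below degree [msize g] keeps all of [g] and nothing of a multiple of
   [x ^+ msize g]. *)
have [g' [Qg' _]] := divx (msize g).
have := gQ _ (msize g) Qg'; rewrite mpartB mpart_id; last first.
  by move=> m mg; apply: msize_mdeg_lt.
rewrite mpart_eq0 ?subr0 // => m.
rewrite mulrC /x mpolyXn (perm_mem (msuppMX _ _)) => /mapP [m' _ ->].
by rewrite mdegD mdegMn mdeg1 mul1n -leqNgt leq_addr.
Qed.

(** In the graded situation [X_v] can be moved from the front of the sequence to its end, past one
    homogeneous element at a time. *)
Lemma weakly_regular_exchange Q v (ys : seq {mpoly K[n]}) : is_ideal Q -> graded Q ->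
  (forall y, y \in ys -> exists d, homogeneous d y) ->
  (forall g, Q ('X_v * g) -> Q g) ->
  weakly_regular ys (ideal_add Q 'X_v) ->
  weakly_regular ys Q /\
  (forall g, ideal_adds Q ys ('X_v * g) -> ideal_adds Q ys g).
Proof.
elim: ys Q => //= y ys IH Q idQ gQ hys regx [regy regys].
have [d hy] : exists d, homogeneous d y by apply: hys; rewrite mem_head.
have [regy' regx'] := regular_exchange idQ gQ hy regx regy.
have [|||||regys' regx''] := IH (ideal_add Q y); last by [].
- exact: ideal_add_ideal.
- exact: graded_add hy.
- by move=> z zys; apply: hys; rewrite inE zys orbT.
- exact: regx'.
- by apply: eq_weakly_regular regys => f; apply: ideal_addC.
Qed.

Definition esyms r : seq {mpoly K[n]} := [seq mesym n K i | i <- iota 1 r].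

Lemma mesym_homogeneous d : homogeneous d (mesym n K d).
Proof.
by move=> m; rewrite mem_msupp_mesym => /andP[/eqP].
Qed.

Lemma esyms_homogeneous r y : y \in esyms r -> exists d, homogeneous d y.
Proof. by move=> /mapP [d _ ->]; exists d; apply: mesym_homogeneous. Qed.

Lemma meets_addX F v f :
  ideal_add (monideal (meets F)) 'X_v f <-> monideal (meets (v |: F)) f.
Proof.
rewrite monideal_addX; last exact: meets_upclosed.
apply: eq_monideal => m; apply/orP/meetsP.
  case=> [/meetsP [v' v'F mv']|mv]; last by exists v => //; rewrite setU11.
  by exists v' => //; rewrite in_setU1 v'F orbT.
case=> v'; rewrite in_setU1 => /orP[/eqP ->|v'F mv']; first by right.
by left; apply/meetsP; exists v'.
Qed.

Lemma meets_regular F m g : ~~ meets F m ->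
  monideal (meets F) ('X_[m] * g) -> monideal (meets F) g.
Proof.
move=> nm; rewrite mulrC => /monidealMX Fg m' /Fg.
by rewrite meetsD (negbTE nm) orbF.
Qed.

Lemma meetsU F v : meets F U_(v)%MM = (v \in F).
Proof.
apply/meetsP/idP => [[j jF]|vF]; last by exists v; rewrite // mnm1E eqxx.
by rewrite mnm1E; case: eqP => // ->.
Qed.

Lemma esyms_regular_aux F r : (r + #|F| < n)%N ->
  (forall v, v \notin F -> weakly_regular (esyms r) (monideal (meets (v |: F)))) ->
  weakly_regular (esyms r) (monideal (meets F)) /\
  forall v, v \notin F -> forall g,
    ideal_adds (monideal (meets F)) (esyms r) ('X_v * g) ->
    ideal_adds (monideal (meets F)) (esyms r) g.
Proof.
move=> ltn IH.
have H v : v \notin F -> weakly_regular (esyms r) (monideal (meets F)) /\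
    forall g, ideal_adds (monideal (meets F)) (esyms r) ('X_v * g) ->
    ideal_adds (monideal (meets F)) (esyms r) g.
  move=> vF; apply: weakly_regular_exchange.
  - by apply: monideal_ideal; apply: meets_upclosed.
  - exact: graded_monideal.
  - exact: esyms_homogeneous.
  - by move=> g; apply: meets_regular; rewrite meetsU.
  by apply: eq_weakly_regular (IH v vF) => f; rewrite meets_addX.
split; last by move=> v /H [].
have : (0 < #|~: F|)%N by rewrite cardsCs setCK card_ord; lia.
by case/card_gt0P => v; rewrite inE => /H [].
Qed.

(* The last symmetric polynomial is, modulo P_F, the product of the variables *)
(* outside F.                                                                 *)
Lemma esyms_regular F r : (r + #|F| <= n)%N ->
  weakly_regular (esyms r) (monideal (meets F)).
Proof.
(* Induction on the number of variables outside [F]: enlarging [F] by one variable covers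
   [r + #|F| < n], and in the boundary case the last symmetric polynomial is treated by itself. *)
move: {2}(n - #|F|)%N (leqnn (n - #|F|)%N) => c.
elim: c F r => [|c IH] F r lec.
  by case: r => [|r] // le; exfalso; lia.
have step r' : (r' + #|F| < n)%N ->
  weakly_regular (esyms r') (monideal (meets F)) /\
  forall v, v \notin F -> forall g,
    ideal_adds (monideal (meets F)) (esyms r') ('X_v * g) ->
    ideal_adds (monideal (meets F)) (esyms r') g.
  move=> lt; apply: esyms_regular_aux => // v vF.
  by apply: IH; rewrite cardsU1 vF; lia.
case: ltngtP => // [/step []//|rF _].
case: r rF => [|r] rF //.
have [regr regv] := step r ltac:(lia).
rewrite /esyms -[r.+1]addn1 iotaD map_cat cats1 add1n.
apply/weakly_regular_rcons; split=> // g.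
have idJ := monideal_ideal K (@meets_upclosed n F).
have idJs := ideal_adds_ideal (esyms r) idJ.
have sym : monideal (meets F) (mesym n K r.+1 - 'X_[mesym1 (~: F)]).
  rewrite mesymE (bigD1 (~: F)) /=; last first.
    by rewrite cardsCs setCK card_ord; apply/eqP; lia.
  rewrite addrAC subrr add0r; apply: ideal_sum => // A /andP[/eqP cA nA].
  apply/monidealX; apply: contraT => nm; case/eqP: nA.
  apply/eqP; rewrite eqEcard [#|~: F|]cardsCs setCK card_ord.
  apply/andP; split; last by rewrite cA; lia.
  apply/subsetP => v vA; rewrite inE; apply: contra nm => vF.
  by apply/meetsP; exists v; rewrite // mnmE vA.
move=> Jg; have {}Jg : ideal_adds (monideal (meets F)) (esyms r) ('X_[mesym1 (~: F)] * g).
  have -> : 'X_[mesym1 (~: F)] * g =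
    mesym n K r.+1 * g - (mesym n K r.+1 - 'X_[mesym1 (~: F)]) * g by ring.
  apply: idealB => //; apply: ideal_mulr => //; exact: ideal_addsW.
move: Jg; rewrite mpolyXE_id.
elim: (index_enum _) g => [|v s IHs] g; first by rewrite big_nil mul1r.
rewrite big_cons mnmE inE; case: (boolP (v \in F)) => vF.
  by rewrite expr0 mul1r; apply: IHs.
by rewrite expr1 -mulrA => /(regv v vF); apply: IHs.
Qed.

(** A filtration of [S/J] obtained by repeatedly splitting [J] into [J : X_v] and [J + (X_v)], with
    factors [S/P_F], [F] of size at most [c], or zero. *)
Inductive prime_filtered (c : nat) : pred 'X_{1..n} -> Prop :=
| PF_prime U F : (#|F| <= c)%N -> U =1 meets F -> prime_filtered c U
| PF_unit U : (forall m, U m) -> prime_filtered c U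
| PF_split U v : prime_filtered c (fun m => U (m + U_(v))%MM) ->
    prime_filtered c (fun m => U m || (0 < m v)%N) -> prime_filtered c U.

Lemma prime_filtered_regular c r U : (r + c <= n)%N -> prime_filtered c U ->
  upclosed U -> weakly_regular (esyms r) (monideal U).
Proof.
move=> lerc; elim=> {U} [U F lec eU|U UT|U v _ IHc _ IHa] upU.
- apply: (@eq_weakly_regular _ _ (monideal (meets F))).
    by move=> f; apply: eq_monideal => m; rewrite eU.
  by apply: esyms_regular; lia.
- have : forall f, monideal U f by move=> f m _.
  elim: (esyms r) (monideal U) => //= y s IH Q QT; split=> //.
  by apply: IH => f; apply: ideal_addW.
apply: (@weakly_regular_split _ _ _ 'X_v); first exact: monideal_ideal.
  apply: eq_weakly_regular (IHc _) => [f|m m' /upU Um le].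
    by rewrite -monidealMX mulrC.
  by apply: Um; apply/mnm_lepP => j; rewrite !mnmDE leq_add2r (mnm_lepP le).
apply: eq_weakly_regular (IHa _) => [f|m m' /orP[/upU Um /Um ->//|mv] le].
  by rewrite monideal_addX.
by apply/orP; right; apply: leq_trans mv _; apply: (mnm_lepP le).
Qed.

Lemma eq_prime_filtered c U U' :
  U =1 U' -> prime_filtered c U -> prime_filtered c U'.
Proof.
move=> e pU; elim: pU U' e => {U} [U F lec eU|U UT|U v _ IHc _ IHa] U' e.
- by apply: PF_prime lec _ => m; rewrite -e.
- by apply: PF_unit => m; rewrite -e.
apply: (@PF_split _ _ v); [apply: IHc|apply: IHa] => m; by rewrite e.
Qed.

Definition mset m v (a : nat) : 'X_{1..n} := [multinom if j == v then a else m j | j < n].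

(** Taking the colon by [X_v] repeatedly, [a] times in all, leaves one slice with [X_v] killed for
    each exponent below [a], and finally the colon by [X_v ^+ a]. *)
Lemma prime_filtered_slices c U v a :
  (forall a', (a' < a)%N -> prime_filtered c (fun m => U (mset m v a') || (0 < m v)%N)) ->
  prime_filtered c (fun m => U (m + U_(v) *+ a)%MM) -> prime_filtered c U.
Proof.
elim: a U => [|a IH] U slices last.
  by apply: eq_prime_filtered last => m; rewrite mulm0n addm0.
apply: (@PF_split _ _ v).
  apply: IH => [a' lta|].
    apply: eq_prime_filtered (slices a'.+1 lta) => m; congr (U _ || _).
    apply/mnmP => j; rewrite mnmDE !mnmE eq_sym; case: eqP; lia.
  apply: eq_prime_filtered last => m; congr (U _).
  by rewrite -addmA [(_ *+ _ + _)%MM]addmC -mulmS.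
apply: eq_prime_filtered (slices 0%N isT) => m.
case: (posnP (m v)) => [mv|]; last by rewrite !orbT.
congr (U _ || _); apply/mnmP => j; rewrite mnmE; case: eqP => // ->.
by rewrite mv.
Qed.

End SymmetricSequences.

(** * Exponent vectors and the PLP polymatroid *)

(** Discrete intermediate values: a box of integer vectors attains every sum between its
    extremes. *)
Lemma sum_nat_between (lo up : nat -> nat) i j t :
  (forall l, i <= l < j -> lo l <= up l) ->
  \sum_(i <= l < j) lo l <= t <= \sum_(i <= l < j) up l ->
  exists2 u : nat -> nat, (forall l, i <= l < j -> lo l <= u l <= up l)
    & \sum_(i <= l < j) u l = t.
Proof.
elim: j t => [|j IH] t loup.
  by rewrite !big_geq // => /andP[_]; rewrite leqn0 => /eqP ->;
     exists lo => [l|]; [lia | rewrite big_geq].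
case: (leqP i j) => ij; last first.
  by rewrite !big_geq // => /andP[_]; rewrite leqn0 => /eqP ->;
     exists lo => [l|]; [lia | rewrite big_geq].
rewrite !big_nat_recr //= => /andP[lot tup].
have loupj := loup j ltac:(lia).
have : \sum_(i <= l < j) lo l <= \sum_(i <= l < j) up l.
  by rewrite !big_nat; apply: leq_sum => l lij; apply: loup; lia.
set L := \sum_(i <= l < j) lo l in lot *.
set V := \sum_(i <= l < j) up l in tup *.
move=> LV; pose x := maxn (lo j) (t - V).
have [|| u loup' su] := IH (t - x); first by move=> l lij; apply: loup; lia.
  by rewrite -/L -/V /x; lia.
exists (fun l => if l == j then x else u l).
  move=> l lij; case: eqP => [->|ne]; first by rewrite /x; lia.
  by apply: loup'; lia.
rewrite big_nat_recr //= eqxx -[RHS](@subnK x t); last by rewrite /x; lia.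
congr (_ + _); rewrite -su !big_nat; apply: eq_bigr => l lij.
by case: eqP => //; lia.
Qed.

Section Exponents.
Variable n : nat.
Implicit Types (w u m : 'X_{1..n}).

(** Exponents and prefix sums are indexed by all natural numbers, with exponent zero from [n] on, so
    that inductions along the path avoid ordinals. *)
Definition expo m i := nth 0 m i.
Definition cum m i := \sum_(0 <= j < i) expo m j.
Definition mnm_of (e : nat -> nat) : 'X_{1..n} := [multinom e i | i < n].

Lemma expoE m (v : 'I_n) : expo m v = m v.
Proof. by rewrite /expo -mnm_nth. Qed.

Lemma expo_out m i : n <= i -> expo m i = 0.
Proof. by move=> ni; rewrite /expo nth_default // size_tuple. Qed.

Lemma expo_of e i : expo (mnm_of e) i = if i < n then e i else 0.
Proof.
case: ltnP => ni; last exact: expo_out.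
by rewrite -[i]/(val (Ordinal ni)) expoE mnmE.
Qed.

Lemma expoD m m' i : expo (m + m')%MM i = expo m i + expo m' i.
Proof.
case: (ltnP i n) => ni; last by rewrite !expo_out.
by rewrite -[i]/(val (Ordinal ni)) !expoE mnmDE.
Qed.

Lemma expoU (v : 'I_n) i : expo U_(v)%MM i = (i == v).
Proof.
case: (ltnP i n) => ni.
  by rewrite -[i]/(val (Ordinal ni)) !expoE mnm1E eq_sym.
by rewrite expo_out //; case: eqP => // e; have := ltn_ord v; lia.
Qed.

Lemma expo_lem m m' : reflect (forall i, expo m i <= expo m' i) (m <= m')%MM.
Proof.
apply: (iffP mnm_lepP) => [le i|le i]; last by rewrite -!expoE.
case: (ltnP i n) => ni; last by rewrite !expo_out.
by rewrite -[i]/(val (Ordinal ni)) !expoE.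
Qed.

Lemma cum0 m : cum m 0 = 0. Proof. exact: big_geq. Qed.
Lemma cumS m i : cum m i.+1 = cum m i + expo m i.
Proof. exact: big_nat_recr. Qed.

Lemma cumD m m' i : cum (m + m')%MM i = cum m i + cum m' i.
Proof.
by elim: i => [|i IH]; rewrite ?(cum0, cumS) ?expoD ?IH; lia.
Qed.

Lemma cumU (v : 'I_n) i : cum U_(v)%MM i = (v < i).
Proof. by elim: i => [|i IH]; rewrite ?(cum0, cumS) ?expoU ?IH; lia. Qed.

Lemma cum_diff_le m m' i j : (forall l, expo m l <= expo m' l) -> i <= j ->
  cum m j + cum m' i <= cum m' j + cum m i.
Proof.
move=> le; elim: j => [|j IH]; first by rewrite leqn0 => /eqP ->; lia.
rewrite leq_eqVlt => /predU1P [->|]; first by lia.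
by rewrite ltnS => /IH; rewrite !cumS; have := le j; lia.
Qed.

Lemma cum_le m i j : i <= j -> cum m i <= cum m j.
Proof.
elim: j => [|j IH]; first by rewrite leqn0 => /eqP ->.
rewrite leq_eqVlt => /predU1P [->//|]; rewrite ltnS => /IH.
by rewrite cumS; lia.
Qed.

Lemma expo_le_cum m i j : i < j -> expo m i <= cum m j.
Proof. by move=> /(@cum_le m); rewrite cumS; lia. Qed.

Lemma cumE m i : i <= n -> cum m i = \sum_(j < n | j < i) m j.
Proof.
move=> lei; rewrite /cum big_mkord (big_ord_widen n (expo m)) //.
by apply: eq_bigr => j _; rewrite expoE.
Qed.

Lemma cum_mdeg m : cum m n = mdeg m.
Proof.
by rewrite mdegE /cum big_mkord; apply: eq_bigr => j _; rewrite expoE.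
Qed.

Lemma cum_eq m m' i j : i <= j -> (forall l, i <= l < j -> expo m l = expo m' l) ->
  cum m j + cum m' i = cum m' j + cum m i.
Proof.
move=> + e; elim: j e => [|j IH] e; first by rewrite leqn0 => /eqP ->; lia.
rewrite leq_eqVlt => /predU1P [->|]; first by lia.
rewrite ltnS => ij; rewrite !cumS (e j); last by lia.
by have := IH (fun l lij => e l ltac:(lia)) ij; lia.
Qed.

End Exponents.

(** The data normalised by [al 0 = be 0 = 0], so that the empty prefix is a constraint like the
    others. Variables are counted from 0, hence variable [j] has the bound [b j.+1]. *)
Record plp (n k d : nat) (al be b : nat -> nat) : Prop := Plp {
  plp_k : 0 < k < n;
  plp_d : 0 < d;
  plp_al0 : al 0 = 0;
  plp_be0 : be 0 = 0;
  plp_albe : forall i, i <= k -> al i <= be i;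
  plp_al : forall i j, i <= j <= k -> al i <= al j;
  plp_be : forall i j, i <= j <= k -> be i <= be j;
  plp_be1 : 0 < be 1;
  plp_bed : be k <= d;
  plp_b : forall j, k <= j < n -> 0 < b j.+1;
  plp_dle : d <= be k + \sum_(k <= j < n) b j.+1
}.

Section UpSet.
Variables (n k d : nat) (al be b : nat -> nat).
Hypothesis H : plp n k d al be b.
Implicit Types (w u m : 'X_{1..n}).

Definition plp_base u :=
  [/\ forall i, i <= k -> al i <= cum u i <= be i,
      forall j, k <= j < n -> expo u j <= b j.+1
    & cum u n = d].

Definition plp_btail i := \sum_(i <= j < n) b j.+1.

(* A lower bound for u_1 + ... + u_i on the polytope, attained for i <= k.    *)
Definition plp_low i :=
  maxn (if i <= k then al i else 0) (if k <= i then d - plp_btail i else 0).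

Definition plp_wtail w := \sum_(k <= j < n) minn (expo w j) (b j.+1).

(* The largest value of u_1 + ... + u_i for u <= w satisfying the upper       *)
(* bounds is obtained greedily.                                               *)
Definition plp_step i s x :=
  if i < k then minn (s + x) (be i.+1) else s + minn x (b i.+1).

Fixpoint plp_state w i := if i is i'.+1 then plp_step i' (plp_state w i') (expo w i') else 0.

(** The test may start at any position with any state: once the first exponents are fixed, a test of
    the same form remains, which is what the filtration by exponents recurses on. *)
Fixpoint plp_ok r i s w : bool :=
  if r is r'.+1 then
    let s' := plp_step i s (expo w i) in (plp_low i.+1 <= s') && plp_ok r' i.+1 s' w
  else true.

Definition plp_up w := plp_ok n 0 0 w.

Lemma btail_out i : n <= i -> plp_btail i = 0.
Proof. exact: big_geq. Qed.

Lemma plp_okP r i w : reflect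
  (forall j, i <= j < i + r -> plp_low j.+1 <= plp_state w j.+1)
  (plp_ok r i (plp_state w i) w).
Proof.
elim: r i => [|r IH] i /=; first by constructor; lia.
apply: (iffP andP) => [[le /(IH i.+1) ok] j ij|ok].
  have [->//|ne] := eqVneq j i; apply: ok; lia.
split; first by apply: (ok i); lia.
by apply/(IH i.+1) => j ij; apply: ok; lia.
Qed.

Lemma plp_upE w : reflect (forall j, j < n -> plp_low j.+1 <= plp_state w j.+1) (plp_up w).
Proof. by apply: (iffP (plp_okP n 0 w)) => ok j lt; apply: ok; lia. Qed.

Lemma base_tail_le u i j : plp_base u -> k <= i -> i <= j <= n ->
  cum u j <= cum u i + \sum_(i <= l < j) b l.+1.
Proof.
case=> _ ub _ ki; elim: j => [|j IH] ij.
  by have -> : i = 0; [lia | rewrite big_geq // addn0].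
have [->|ne] := eqVneq i j.+1; first by rewrite big_geq // addn0.
rewrite cumS big_nat_recr /=; last by lia.
have := IH ltac:(lia); have := ub j ltac:(lia); lia.
Qed.

Lemma low_le_base u i : plp_base u -> i <= n -> plp_low i <= cum u i.
Proof.
move=> bu lei; case: (bu) => ual ub ud; rewrite /plp_low geq_max; apply/andP; split.
  by case: ifP => // ik; have := ual i ik; lia.
case: ifP => // ki; have := base_tail_le bu ki (j := n).
by rewrite lei leqnn => /(_ isT); rewrite -/(plp_btail i); lia.
Qed.

Lemma state_base u w i : plp_base u -> (u <= w)%MM -> i <= n ->
  cum u i <= plp_state w i.
Proof.
move=> [ual ub _] /expo_lem uw; elim: i => [|i IH] lei; first by rewrite cum0.
rewrite cumS /= /plp_step; have := IH (ltnW lei); have := uw i.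
case: ltnP => ik; last by have := ub i ltac:(lia); lia.
by have := ual i.+1 ik; rewrite cumS; lia.
Qed.

Lemma base_plp_up u w : plp_base u -> (u <= w)%MM -> plp_up w.
Proof.
move=> bu uw; apply/plp_upE => j ltj.
exact: leq_trans (low_le_base bu ltj) (state_base bu uw ltj).
Qed.

Lemma state_le_be w i : i <= k -> plp_state w i <= be i.
Proof.
case: i => //= i lti; rewrite /plp_step lti; exact: geq_minr.
Qed.

Lemma be_mono i j : i <= j -> j <= k -> be i <= be j.
Proof. by move=> ij jk; apply: (plp_be H); rewrite ij. Qed.

Lemma al_mono i j : i <= j -> j <= k -> al i <= al j.
Proof. by move=> ij jk; apply: (plp_al H); rewrite ij. Qed.

Lemma state_step w i : i < k -> plp_state w i <= plp_state w i.+1 <= plp_state w i + expo w i.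
Proof.
move=> ik; rewrite /= /plp_step ik.
have := state_le_be w (ltnW ik); have := be_mono (leqnSn i) ik; lia.
Qed.

(** Here [j] is the last position where the greedy sum was capped by [be], or 0; after it nothing is
    lost. *)
Lemma state_form w i : i <= k ->
  exists2 j, j <= i & plp_state w i + cum w j = be j + cum w i.
Proof.
elim: i => [|i IH] ik; first by exists 0; rewrite ?(plp_be0 H).
have [j ji e] := IH (ltnW ik); rewrite /= /plp_step ik.
case: (leqP (plp_state w i + expo w i) (be i.+1)) => le.
  by exists j; [lia | rewrite cumS; lia].
by exists i.+1; [lia | rewrite addnC].
Qed.

Lemma state_tail w i : k <= i ->
  plp_state w i = plp_state w k + \sum_(k <= l < i) minn (expo w l) (b l.+1).
Proof.
elim: i => [|i IH] ki; first by have -> : k = 0; [lia|rewrite big_geq // addn0].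
have [->|ne] := eqVneq k i.+1; first by rewrite big_geq // addn0.
rewrite big_nat_recr /=; last by lia.
rewrite /plp_step ltnNge (_ : k <= i) /=; last by lia.
by rewrite IH; lia.
Qed.

Lemma al_low i : i <= k -> al i <= plp_low i.
Proof. by move=> ik; rewrite /plp_low ik leq_maxl. Qed.

Lemma low_al i : i < k -> plp_low i = al i.
Proof.
by move=> ik; rewrite /plp_low ltnW // leqNgt ik /= maxn0.
Qed.

Lemma low_n : plp_low n = d.
Proof.
have := plp_k H; rewrite /plp_low btail_out // subn0.
by case: ifP; case: ifP; lia.
Qed.

Lemma low_k : d <= plp_low k + plp_btail k.
Proof. by rewrite /plp_low !leqnn; lia. Qed.

Lemma plp_up_base w : plp_up w -> exists2 u, plp_base u & (u <= w)%MM.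
Proof.
move=> /plp_upE ok; have := plp_k H => /andP[k0 kn].
have okk : d <= plp_state w k + plp_wtail w.
  have := ok n.-1 ltac:(lia); rewrite prednK; last by lia.
  by rewrite low_n (state_tail w (ltnW kn)).
have skd : plp_state w k <= d.
  exact: leq_trans (state_le_be w (leqnn k)) (plp_bed H).
have [||t tlo ts] := @sum_nat_between (fun=> 0)
  (fun l => minn (expo w l) (b l.+1)) k n (d - plp_state w k); first by [].
  by rewrite big1 // -/(plp_wtail w); lia.
(* The generator follows the greedy sums on the path; the rest of the degree is spread over the tail
   by interpolation. *)
pose e l := if l < k then plp_state w l.+1 - plp_state w l else t l.
have cue i : i <= k -> cum (mnm_of n e) i = plp_state w i.
  elim: i => [|i IH] ik; rewrite ?cum0 // cumS IH ?(ltnW ik) //.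
  rewrite expo_of (_ : i < n); last by lia.
  by rewrite /e ik; have := state_step w ik; lia.
have cun : cum (mnm_of n e) n = d.
  rewrite /cum (big_cat_nat (n := k)) //=; last by exact: ltnW.
  rewrite -/(cum (mnm_of n e) k) cue // big_nat.
  rewrite (eq_bigr t) => [|l /andP[kl ln]]; last first.
    by rewrite expo_of ln /e ltnNge kl.
  by rewrite -big_nat ts; lia.
exists (mnm_of n e).
  split=> // [i ik|j /andP[kj jn]].
    rewrite cue // state_le_be // andbT.
    case: i ik => [|i] ik; first by rewrite (plp_al0 H).
    by apply: leq_trans (al_low ik) _; apply: ok; lia.
  by rewrite expo_of jn /e ltnNge kj /=; have := tlo j; lia.
apply/expo_lem => l; rewrite expo_of; case: ifP => // ln; rewrite /e.
by case: ltnP => lk; [have := state_step w lk|have := tlo l]; lia.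
Qed.

Lemma plp_upP w : plp_up w <-> exists2 u, plp_base u & (u <= w)%MM.
Proof.
by split=> [/plp_up_base //|[u bu uw]]; apply: base_plp_up uw.
Qed.

(** For [i <= k] the greedy sum is the minimum of [be j + cum w i - cum w j] over [j <= i]. The
    tests beyond [k] follow from the one at [n], since a tail segment contributes at most its share
    of [plp_btail]. *)
Lemma plp_up_ineq w : plp_up w <->
  (forall j i, j <= i -> i <= k -> plp_low i + cum w j <= be j + cum w i) /\
  (forall j, j <= k -> d + cum w j <= be j + cum w k + plp_wtail w).
Proof.
have := plp_k H => /andP[k0 kn]; split.
  case/plp_upP => u bu /expo_lem uw; have [ual ub ud] := bu; split=> [j i ji ik|j jk].
    have := low_le_base bu (leq_trans ik (ltnW kn)).
    have := ual j (leq_trans ji ik).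
    by have := cum_diff_le uw ji; lia.
  have := ual j jk; have := cum_diff_le uw jk.
  suff : cum u n <= cum u k + plp_wtail w by lia.
  rewrite /cum (big_cat_nat (n := k)) //=; last exact: ltnW.
  rewrite leq_add2l /plp_wtail !big_nat; apply: leq_sum => l lkn.
  by have := uw l; have := ub l lkn; lia.
case=> I1 I2; apply/plp_upE => i lti.
case: (leqP i.+1 k) => ik.
  have [j ji] := state_form w ik; have := I1 j i.+1 ji ik; lia.
have [j jk] := state_form w (leqnn k); have := I2 j jk.
rewrite (state_tail w (i := i.+1)); last by lia.
have -> : plp_low i.+1 = d - plp_btail i.+1.
  by rewrite /plp_low leqNgt ik /= ltnW // max0n.
rewrite /plp_wtail (big_cat_nat (n := i.+1)) //=; last by lia.
suff : \sum_(i.+1 <= l < n) minn (expo w l) (b l.+1) <= plp_btail i.+1 by lia.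
by apply: leq_sum => l _; apply: geq_minr.
Qed.

Lemma plp_up_upclosed : upclosed plp_up.
Proof.
move=> m m' /plp_upP [u bu um] mm'; apply/plp_upP; exists u => //.
exact: lepm_trans mm'.
Qed.

Lemma plp_up_bounded m m' : plp_up m ->
  (forall v, minn (m v) d <= m' v) -> plp_up m'.
Proof.
move=> /plp_upP [u bu /mnm_lepP um] mm'; apply/plp_upP; exists u => //.
apply/mnm_lepP => v; apply: leq_trans (mm' v); rewrite leq_min um.
have [_ _ <-] := bu; rewrite -expoE; exact: expo_le_cum.
Qed.

End UpSet.

(** * Lower bound for the depth *)

Section Filtration.
Variables (n k d : nat) (al be b : nat -> nat).
Hypothesis H : plp n k d al be b.
Implicit Types (w u m : 'X_{1..n}) (F : {set 'I_n}) (v : 'I_n).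

Notation low := (plp_low n k d al b).
Notation btail := (plp_btail n b).
Notation step := (plp_step k be b).
Notation ok := (plp_ok k d al be b).
Notation up := (plp_up k d al be b).

(** In the notation of the overview, [plp_slack] is Delta, [plp_path_rank k] is C and
    [plp_tail_rank] is D. Tightness forces the degree of every generator in the path variables;
    degeneracy says that moreover no tail variable divides a generator. *)
Definition plp_slack := be k + btail k - d.
Definition plp_tight := low k == be k.
Definition plp_degenerate := plp_tight && (be k == d).
Definition plp_tail_rank :=
  if plp_degenerate then 0 else minn (n - k - plp_tight) plp_slack.
Definition plp_path_rank i := \sum_(1 <= q < i) (al q < be q).

Lemma meetsU1 F v m : meets (v |: F) m = (0 < m v) || meets F m.
Proof.
apply/meetsP/orP => [[j]|].
  rewrite in_setU1 => /orP[/eqP ->|jF mj]; first by left.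
  by right; apply/meetsP; exists j.
case=> [mv|/meetsP [j jF mj]]; first by exists v; rewrite // setU11.
by exists j; rewrite // setU1r.
Qed.

Lemma eq_plp_ok r i s m m' : (forall j, i <= j -> expo m j = expo m' j) ->
  ok r i s m = ok r i s m'.
Proof.
elim: r i s => //= r IH i s e; rewrite e //; congr (_ && _).
by apply: IH => j ij; apply: e; lia.
Qed.

Lemma btail_cat i : k <= i <= n -> btail k = \sum_(k <= l < i) b l.+1 + btail i.
Proof. by move=> ki; rewrite /plp_btail -big_cat_nat //=; lia. Qed.

(* f bounds the number of variables of the current prime: on the path, the    *)
(* positions with al < be; on the tail, both the slack already consumed and   *)
(* the number of tail variables seen.                                         *)
Definition filtration_inv i s f :=
  if i < k then s <= be i /\ f <= plp_path_rank i.+1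
  else [/\ s <= be k + \sum_(k <= l < i) b l.+1,
    f <= plp_path_rank k + (be k + \sum_(k <= l < i) b l.+1 - s),
    f <= plp_path_rank k + (1 - plp_tight) + (i - k),
    low i <= s & plp_degenerate -> be k <= s].

Definition step_room i s := if i < k then be i.+1 - s else b i.+1.

Lemma step_unsat i s a : a <= step_room i s -> filtration_inv i s 0 ->
  i < n -> step i s a = s + a.
Proof.
rewrite /step_room /filtration_inv /plp_step; case: ifP => ik.
  by move=> le [sbe _] _; have := be_mono H (leqnSn i) ik; lia.
by move=> le _ _; lia.
Qed.

Lemma path_rankS i : 0 < i -> plp_path_rank i.+1 = plp_path_rank i + (al i < be i).
Proof. exact: big_nat_recr. Qed.

Lemma path_rank_le i j : i <= j -> plp_path_rank i <= plp_path_rank j.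
Proof.
elim: j => [|j IH]; first by rewrite leqn0 => /eqP ->.
rewrite leq_eqVlt => /predU1P [->//|]; rewrite ltnS => /IH le.
case: j {IH} le => [|j] le; last by rewrite path_rankS //; lia.
by apply: leq_trans le _; rewrite /plp_path_rank !big_geq.
Qed.

(** On the tail, [low i <= s] bounds the consumed slack by Delta and [i < n] bounds the number of
    tail variables, so [f] is at most C + D; a degenerate branch never fails there. The inequality
    is strict in order to leave room for the variable of a slice. *)
Lemma inv_leaf i s f : i < n -> filtration_inv i s f ->
  s + step_room i s < low i.+1 \/ (exists2 a, a < step_room i s & s + a < low i.+1) ->
  f < plp_path_rank k + plp_tail_rank + 1.
Proof.
move=> lti; have := plp_k H => /andP[k0 kn].
rewrite /filtration_inv; case: ltnP => ik.
  by case=> _ le _; have := path_rank_le ik; lia.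
case=> s1 f1 f2 lows degs viol.
have {}viol : s < low i.+1 by case: viol => [|[a _]]; lia.
have le1 : low i.+1 <= d by rewrite /plp_low; case: ifP; case: ifP; lia.
have := btail_cat (i := i) ltac:(lia).
have := low_k n k d al b.
have : d - btail i <= low i by rewrite /plp_low ik leq_maxr.
rewrite /plp_tail_rank; case: ifP => [deg|_].
  by have := degs deg; move: deg => /andP[_ /eqP ->]; lia.
by rewrite /plp_slack; case: (plp_tight) f2 => /=; lia.
Qed.

Lemma inv_step i s f a : i < n -> filtration_inv i s f -> a <= step_room i s ->
  low i.+1 <= s + a ->
  filtration_inv i.+1 (s + a) (f + (a < step_room i s)).
Proof.
move=> lti; have := plp_k H => /andP[k0 kn].
rewrite /filtration_inv /step_room; case: (ltnP i k) => ik; last first.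
  rewrite ltnNge (_ : k <= i.+1) /=; last by lia.
  case=> s1 f1 f2 lows degs lea lowS; rewrite big_nat_recr //=.
  split.
  - lia.
  - lia.
  - lia.
  - exact: lowS.
  - by move/degs; lia.
case=> sbe fle lea lowS.
have sa : s + a <= be i.+1.
  by have := be_mono H (leqnSn i) ik; lia.
case: ltnP => ik'.
  (* An unsaturated step ends with [al i.+1 <= s + a < be i.+1], so this position is counted by
     [plp_path_rank]. *)
  split=> //; rewrite path_rankS //; move: lowS; rewrite low_al //; lia.
have ek : i.+1 = k by lia.
rewrite -ek big_geq // addn0 subnn addn0 ek in sa lowS lea *.
split=> //.
- move: fle; rewrite ek; lia.
- move: fle; rewrite ek /plp_tight; case: eqP => [e|_] /=; lia.
- rewrite /plp_degenerate /plp_tight => /andP[/eqP e _]; lia.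
Qed.

(** Branch on the exponent of variable [i]: each value below [step_room] gives a slice in which the
    variable joins [F], and all values from [step_room] on lead to one saturated state. *)
Lemma plp_prime_filtered_aux r i s F : r + i = n ->
  (forall v, v \in F -> v < i) -> filtration_inv i s #|F| ->
  prime_filtered (plp_path_rank k + plp_tail_rank + 1)
    (fun m => meets F m || ok r i s m).
Proof.
elim: r i s F => [|r IH] i s F rin Fi inv.
  by apply: PF_unit => m; rewrite orbT.
have lti : i < n by lia.
pose v : 'I_n := Ordinal lti.
have vF : v \notin F by apply/negP => /Fi /=; lia.
have inv0 : filtration_inv i s 0.
  by move: inv; rewrite /filtration_inv; case: ifP => _ [? ? *]; split.
pose rest F' s' m := meets F' m || (low i.+1 <= s') && ok r i.+1 s' m.
have restP F' s' : (low i.+1 <= s' -> filtration_inv i.+1 s' #|F'|) ->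
    (s' < low i.+1 -> #|F'| <= plp_path_rank k + plp_tail_rank + 1) ->
    (forall v, v \in F' -> v < i.+1) ->
    prime_filtered (plp_path_rank k + plp_tail_rank + 1) (rest F' s').
  move=> inv1 leaf F'i; case: (ltnP s' (low i.+1)) => lows; last first.
    apply: eq_prime_filtered (IH i.+1 s' F' ltac:(lia) F'i (inv1 lows)) => m.
    by rewrite /rest lows.
  apply: PF_prime (leaf lows) _ => m.
  by rewrite /rest leqNgt lows orbF.
have Fmeet m m' : (forall j, j != i -> expo m j = expo m' j) -> meets F m = meets F m'.
  move=> e; apply: eq_existsb => j; case: (boolP (j \in F)) => //= jF.
  by rewrite -!expoE e //; have := Fi j jF; lia.
apply: (@prime_filtered_slices _ _ _ v (step_room i s)) => [a lta|].
  apply: eq_prime_filtered (restP (v |: F) (s + a) _ _ _) => [m|lows|lows|v'].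
  - have e j : j != i -> expo (mset m v a) j = expo m j.
      move=> ne; case: (ltnP j n) => jn; last by rewrite !expo_out.
      rewrite -[j]/(val (Ordinal jn)) !expoE mnmE; case: eqP => // ev.
      by case/eqP: ne; have := congr1 val ev.
    have ei : expo (mset m v a) i = a.
      by rewrite -[i]/(val v) expoE mnmE eqxx.
    rewrite /rest meetsU1 (Fmeet _ _ e) /= ei (step_unsat _ inv0 lti); last exact: ltnW.
    rewrite (@eq_plp_ok r i.+1 _ (mset m v a) m) => [|j ij]; last by apply: e; lia.
    by case: (0 < m v); rewrite ?orbT ?orbF.
  - have := inv_step lti inv (ltnW lta) lows.
    by rewrite lta cardsU1 vF addn1 add1n.
  - rewrite cardsU1 vF; have := inv_leaf lti inv; rewrite add1n; apply.
    by right; exists a.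
  - by rewrite in_setU1 => /orP[/eqP ->|/Fi /=]; rewrite /=; lia.
apply: eq_prime_filtered (restP F (s + step_room i s) _ _ _) => [m|lows|lows|v'].
- rewrite /rest.
  have e j : expo (m + U_(v) *+ step_room i s)%MM j =
      expo m j + (j == i) * step_room i s.
    rewrite expoD; congr (_ + _).
    case: (ltnP j n) => jn; last by rewrite expo_out //; case: eqP => //; lia.
    by rewrite -[j]/(val (Ordinal jn)) expoE mulmnE mnm1E -val_eqE eq_sym.
  have e' j : j != i -> expo m j = expo (m + U_(v) *+ step_room i s)%MM j.
    by move=> ne; rewrite e (negbTE ne) addn0.
  rewrite (Fmeet _ _ e') /= e eqxx mul1n.
  have -> : step i s (expo m i + step_room i s) = s + step_room i s.
    move: inv0; rewrite /filtration_inv /step_room /plp_step; case: ifP => ik.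
      by case=> sbe _; have := be_mono H (leqnSn i) ik; lia.
    by move=> _; lia.
  by congr (_ || (_ && _)); apply: eq_plp_ok => j ij; apply: e'; lia.
- by have := inv_step lti inv (leqnn _) lows; rewrite ltnn addn0.
- by have := inv_leaf lti inv (or_introl lows); lia.
- by move=> /Fi; lia.
Qed.

Lemma plp_prime_filtered :
  @prime_filtered n (plp_path_rank k + plp_tail_rank + 1) up.
Proof.
apply: eq_prime_filtered (@plp_prime_filtered_aux n 0 0 set0 _ _ _) => [m|||].
- rewrite /plp_up (_ : meets set0 m = false) //.
  by apply/meetsP => -[v]; rewrite inE.
- by rewrite addn0.
- by move=> v; rewrite inE.
rewrite /filtration_inv cards0; have := plp_k H; case: (0 < k) => //= _.
Qed.

End Filtration.

(** * Upper bound for the depth *)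

Section Blocks.
Variable cut : nat -> bool.

(* The cuts are the first elements of consecutive blocks; block_of i is the   *)
(* first element of the block of i, and 0 always starts a block.              *)
Fixpoint block_of i := if i is i'.+1 then if cut i then i else block_of i' else 0.

Hypothesis cut0 : cut 0.

Lemma block_of_le i : block_of i <= i.
Proof. by elim: i => //= i IH; case: ifP => // _; exact: leqW. Qed.

Lemma cut_block_of i : cut (block_of i).
Proof. by elim: i => //= i IH; case: ifP. Qed.

Lemma block_of_cut i : cut i -> block_of i = i.
Proof. by case: i => //= i ->. Qed.

Lemma block_of_max q i : cut q -> q <= i -> q <= block_of i.
Proof.
move=> cq; elim: i => [|i IH] //=; case: ifP => // nci.
rewrite leq_eqVlt => /predU1P [e|]; first by rewrite e nci in cq.
by rewrite ltnS.
Qed.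

Variables (n : nat) (M : nat -> nat).

(* In each block with M nonzero at its first element, one unit of M is moved  *)
(* from the first element j to the element a j.                               *)
Definition exchange (a : nat -> nat) i :=
  M i - cut i + (0 < M (block_of i)) * (a (block_of i) == i).

(** Moving a unit from the head of a block to [a j] lowers by one exactly the prefix sums that
    separate the two places. *)
Lemma cum_exchange a i : (forall j, cut j -> j < n -> block_of (a j) = j /\ a j < n) ->
  i <= n ->
  cum (mnm_of n (exchange a)) i
    + ((0 < i) && (0 < M (block_of i.-1)) && (i <= a (block_of i.-1)))
  = \sum_(0 <= l < i) M l.
Proof.
move=> Ha; elim: i => [|i IH] lei; first by rewrite cum0 big_geq.
rewrite cumS big_nat_recr //= -IH ?(ltnW lei) // expo_of lei /exchange.
case: (boolP (cut i)) => ci.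
  rewrite (block_of_cut ci).
  have [ba an] := Ha i ci lei.
  have -> : (0 < i) && (0 < M (block_of i.-1)) && (i <= a (block_of i.-1)) = false.
    apply/negbTE/negP => /andP[/andP[i0 _] le].
    have [|e _] := Ha (block_of i.-1) (cut_block_of _).
      by have := block_of_le i.-1; lia.
    have := block_of_max ci le; rewrite e; have := block_of_le i.-1; lia.
  have := block_of_le (a i); rewrite ba.
  by case: (posnP (M i)) => [->|Mi]; case: eqP; lia.
case: i ci lei {IH} => [|i] ci lei; first by rewrite cut0 in ci.
rewrite /= (negbTE ci).
case: (posnP (M (block_of i))) => [z|nz] /=.
  by lia.
by case: eqP; lia.
Qed.

Hypothesis (n_gt0 : 0 < n) (M0 : 0 < M 0).
Hypothesis loop1 : forall i, i < n -> M (block_of i) = 0 -> block_of i = i.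

Variables (K : fieldType) (U : pred 'X_{1..n}).
Hypothesis upU : upclosed U.
Hypothesis exU : forall a,
  (forall j, cut j -> j < n -> block_of (a j) = j /\ a j < n) ->
  U (mnm_of n (exchange a)).
Hypothesis minU : forall (v : 'I_n), 0 < M v -> ~~ U (mnm_of n M - U_(v))%MM.

Local Open Scope ring_scope.

Definition xvar i : {mpoly K[n]} := 'X_[mnm_of n (fun l => (l == i) : nat)].

Lemma xvarE (v : 'I_n) : xvar v = 'X_v.
Proof.
by congr 'X_[_]; apply/mnmP => j; rewrite mnm1E mnmE -val_eqE eq_sym.
Qed.

Lemma prod_mpolyX (I : Type) (s : seq I) (e : I -> nat -> nat) :
  \prod_(j <- s) ('X_[mnm_of n (e j)] : {mpoly K[n]}) =
  'X_[mnm_of n (fun i => \sum_(j <- s) e j i)%N].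
Proof.
elim: s => [|j s IH].
  rewrite big_nil -mpolyX0; congr 'X_[_]; apply/mnmP => i.
  by rewrite !mnmE big_nil.
rewrite big_cons IH -mpolyXD; congr 'X_[_]; apply/mnmP => i.
by rewrite mnmDE !mnmE big_cons.
Qed.

(** The sum of [x_i e_i] over the block of [j]. If [M j = 0] there is no unit to move; the block is
    then a singleton ([loop1]), its form is [e_j], and the factor [x_j] appears as a coefficient
    instead. *)
Definition block_form j i : {mpoly K[n]} :=
  if block_of i == j then if (0 < M j)%N then xvar i else 1 else 0.

Let js := [seq q <- iota 1 n.-1 | cut q].

Lemma mem_blocks q : (q \in 0%N :: js) = cut q && (q < n)%N.
Proof.
rewrite inE mem_filter mem_iota; case: q => [|q] /=; first by rewrite cut0 n_gt0.
by rewrite add1n prednK.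
Qed.

Lemma uniq_blocks : uniq (0%N :: js).
Proof.
by rewrite /= mem_filter mem_iota /= andbF /= filter_uniq // iota_uniq.
Qed.

Lemma prod_block_form a :
  (forall j, cut j -> (j < n)%N -> block_of (a j) = j /\ (a j < n)%N) ->
  'X_[mnm_of n (fun i => M i - cut i)%N] * \prod_(j <- 0%N :: js) block_form j (a j)
  = 'X_[mnm_of n (exchange a)] :> {mpoly K[n]}.
Proof.
move=> Ha.
rewrite (eq_big_seq (fun j => 'X_[mnm_of n (fun i => (0 < M j) * (i == a j))%N])).
  rewrite prod_mpolyX -mpolyXD; congr 'X_[_]; apply/mnmP => i.
  rewrite mnmDE !mnmE /exchange; congr (_ + _)%N.
  have bi : block_of i \in 0%N :: js.
    by rewrite mem_blocks cut_block_of /=; have := block_of_le i; have := ltn_ord i; lia.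
  rewrite (bigD1_seq (block_of i)) ?uniq_blocks //= big_seq_cond big1 ?addn0 1?eq_sym //.
  move=> j; rewrite mem_blocks => /andP[/andP[cj ltj] ne].
  case: eqP => e; last by rewrite muln0.
  by have [bj _] := Ha j cj ltj; rewrite e bj eqxx in ne.
move=> j; rewrite mem_blocks => /andP[cj ltj]; have [bj _] := Ha j cj ltj.
rewrite /block_form bj eqxx /xvar; case: ifP => _.
  by congr 'X_[_]; apply/mnmP => i; rewrite !mnmE mul1n.
by rewrite -mpolyX0; congr 'X_[_]; apply/mnmP => i; rewrite !mnmE.
Qed.

Lemma dotp_delta i (g : nat -> {mpoly K[n]}) : (i < n)%N ->
  dotp n (fun l => (l == i)%:R) g = g i.
Proof.
move=> lti; rewrite /dotp (bigD1 (Ordinal lti)) //= eqxx mul1r big1 ?addr0 //.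
by move=> j /eqP ne; case: eqP => [e|_]; rewrite ?mul0r //; case: ne; apply: val_inj.
Qed.

Lemma max_ideal_dotp (y : {mpoly K[n]}) : max_ideal y -> exists a, y = dotp n a xvar.
Proof.
move=> [r [c [g [Gg ->]]]]; elim: r c g Gg => [|r IH] c g Gg.
  by exists (fun=> 0); rewrite big_ord0 /dotp big1 // => i _; rewrite mul0r.
have [a ea] := IH (fun i => c (widen_ord (leqnSn r) i))
  (fun i => g (widen_ord (leqnSn r) i)) (fun i => Gg _).
rewrite big_ord_recr /= ea; have [v ->] := Gg ord_max.
exists (fun i => a i + c ord_max * (i == v)%:R).
rewrite -xvarE -(@dotp_delta v xvar) // /dotp mulr_sumr -big_split /=.
by apply: eq_bigr => i _; rewrite mulrDl mulrA.
Qed.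

(** [regular_size_le] for x^M with a unit removed at each nonzero block head: expanding its product
    with the forms gives exchanged monomials, which lie in the ideal. The coefficient of x^M detects
    the class, as no x^M / x_v lies in the ideal. *)
Lemma block_size_le (ys : seq {mpoly K[n]}) :
  (forall y, y \in ys -> max_ideal y) -> weakly_regular ys (monideal U) ->
  (size ys <= \sum_(1 <= q < n) cut q)%N.
Proof.
move=> ysM regys.
have -> : (\sum_(1 <= q < n) cut q)%N = size js.
  rewrite size_filter -sum1_count [RHS]big_mkcond /index_iota subn1.
  by apply: eq_bigr => q _; case: (cut q).
pose M' := mnm_of n M.
apply: (@regular_size_le _ (monideal U) n xvar block_form (monideal_ideal K upU)
  0%N js 'X_[mnm_of n (fun i => M i - cut i)%N]
  (fun j => if (0 < M j)%N then 1 else xvar j)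
  (fun i l => (l == i)%:R) (fun f => f@_M' = 0) ys) => //.
- exact: uniq_blocks.
- move=> i lti.
  pose f j := (if (0 < M j)%N then 1 else xvar j) * block_form j i.
  have -> : block_form 0%N i = f 0%N by rewrite /f M0 mul1r.
  rewrite -/(f _) -[X in _ = _ + X]/(\sum_(j <- js) f j).
  rewrite -(big_cons _ _ 0%N js xpredT f).
  have bi : block_of i \in 0%N :: js.
    by rewrite mem_blocks cut_block_of /=; have := block_of_le i; lia.
  rewrite (bigD1_seq (block_of i)) ?uniq_blocks //= big1 ?addr0; last first.
    by move=> j ne; rewrite /f /block_form eq_sym (negbTE ne) mulr0.
  rewrite /f /block_form eqxx; case: posnP => z; last by rewrite mul1r.
  by rewrite mulr1 loop1.
- move=> a lta.
  case: (boolP (all (fun j => block_of (a j) == j) (0%N :: js))) => ok.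
    rewrite prod_block_form; last first.
      move=> j cj ltj; split=> //; apply/eqP.
      by apply: (allP ok); rewrite mem_blocks cj.
    apply/monidealX/exU => j cj ltj; split=> //; apply/eqP.
    by apply: (allP ok); rewrite mem_blocks cj.
  case/allPn: ok => j jjs nej.
  rewrite (bigD1_seq j) ?uniq_blocks //= /block_form (negbTE nej) mul0r mulr0.
  exact: ideal0 (monideal_ideal K upU).
- move=> i j; rewrite !mem_blocks => /andP[ci lti] /andP[cj ltj].
  rewrite !dotp_delta // /block_form (block_of_cut ci) eqxx.
  by case: eqP => // ->.
- exact: mcoeff0.
- by move=> f g fM gM; rewrite mcoeffB fM gM subr0.
- move=> i g; rewrite mem_blocks => /andP[ci lti] Ug; rewrite dotp_delta //.
  rewrite -[i]/(val (Ordinal lti)) xvarE; apply: memN_msupp_eq0.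
  rewrite mulrC (perm_mem (msuppMX _ _)); apply/negP => /mapP [m' m'g e].
  have Mi : (0 < M i)%N.
    by have := congr1 (fun m : 'X_{1..n} => m (Ordinal lti)) e; rewrite mnmE mnmDE mnm1E eqxx => ->.
  have := @minU (Ordinal lti) Mi; rewrite -/M' e addmC addmK.
  by rewrite (Ug _ m'g).
rewrite (eq_big_seq (fun j => block_form j j)) => [|j].
  rewrite prod_block_form => [|j cj ltj]; last by rewrite block_of_cut.
  have -> : mnm_of n (exchange id) = M'.
    apply/mnmP => i; rewrite !mnmE /exchange; case: (boolP (cut i)) => ci.
      by rewrite block_of_cut // eqxx; case: (M i) => //= *; lia.
    rewrite subn0; case: eqP => [e|_]; last by rewrite muln0 addn0.
    by move: ci; rewrite -e cut_block_of.
  by rewrite mcoeffX eqxx => /eqP; rewrite oner_eq0.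
by rewrite mem_blocks => /andP[_ ltj]; rewrite dotp_delta.
by move=> y /ysM /max_ideal_dotp.
Qed.

End Blocks.

(** * The depth of the quotient by a PLP ideal *)

Section Depth.
Variables (n k d : nat) (al be b : nat -> nat).
Hypothesis H : plp n k d al be b.

Notation low := (plp_low n k d al b).
Notation btail := (plp_btail n b).
Notation up := (plp_up k d al be b).
Notation slack := (plp_slack n k d be b).
Notation tight := (plp_tight n k d al be b).
Notation degenerate := (plp_degenerate n k d al be b).
Notation path_rank := (plp_path_rank al be k).
Notation tail_rank := (plp_tail_rank n k d al be b).

(** On the path, blocks end where [al = be] forces the prefix sum, so that no unit may cross. On the
    tail exactly D positions are not cuts, and they continue the block just before them. *)
Definition plp_cut q :=
  if q < k then al q == be q
  else if q == k then tight else k + tight + tail_rank <= q.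

Lemma low_le_be i : i <= k -> low i <= be i.
Proof.
move=> ik; have := plp_albe H ik; have := plp_dle H; rewrite -/(btail k) /plp_low ik.
by case: ifP => // ki; have -> : i = k by [lia]; lia.
Qed.

Lemma tail_rank_gt0 : ~~ tight -> 0 < tail_rank.
Proof.
rewrite /plp_tail_rank /plp_degenerate => /negbTE nt; rewrite nt /=.
have := low_le_be (leqnn k); have := low_k n k d al b; have := plp_k H.
by move/eqP: nt; rewrite /plp_slack /=; lia.
Qed.

Lemma tail_rank_le : tail_rank + tight <= n - k.
Proof.
rewrite /plp_tail_rank; have := plp_k H; case: ifP => _; last by lia.
by case: tight => /=; lia.
Qed.

Lemma sum_geq c j : k <= c -> \sum_(k <= i < j) (c <= i) = j - c.
Proof.
move=> kc; elim: j => [|j IH]; first by rewrite big_geq.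
case: (leqP k j) => kj; last by rewrite big_geq; lia.
by rewrite big_nat_recr //= IH; lia.
Qed.

Lemma sum_cut_tail : \sum_(k <= q < n) plp_cut q = n - k - tail_rank.
Proof.
have := plp_k H => /andP[k0 kn]; have tn := tail_rank_le.
case: (boolP tight) => [t|nt]; last first.
  have D0 := tail_rank_gt0 nt.
  rewrite -subnDA -(@sum_geq (k + tail_rank) n) ?leq_addr // !big_nat.
  apply: eq_bigr => q kq; rewrite /plp_cut (negbTE nt).
  by case: ifP; [lia | case: eqP; lia].
rewrite big_ltn // /plp_cut ltnn eqxx t /= in tn *.
rewrite (_ : \sum_(k.+1 <= q < n) _ = \sum_(k.+1 <= q < n) (k + 1 + tail_rank <= q)).
  have := @sum_geq (k + 1 + tail_rank) n ltac:(lia).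
  by rewrite big_ltn //; case: leqP; lia.
rewrite !big_nat; apply: eq_bigr => q kq.
by case: ifP; [lia | case: eqP; lia].
Qed.

Lemma sum_cut : \sum_(1 <= q < n) plp_cut q + (path_rank + tail_rank) + 1 = n.
Proof.
have := plp_k H => /andP[k0 kn]; have tn := tail_rank_le.
rewrite (big_cat_nat (n := k)) //=; last exact: ltnW.
rewrite sum_cut_tail.
suff : \sum_(1 <= q < k) plp_cut q + path_rank = k - 1 by lia.
rewrite /plp_path_rank -big_split /= big_nat (eq_bigr (fun=> 1)).
  by rewrite -big_nat sum_nat_const_nat muln1.
move=> q kq; rewrite /plp_cut.
have := plp_albe H (i := q) ltac:(lia).
by case: ifP => [_|]; [case: ltngtP; lia | lia].
Qed.

Lemma plp_cut0 : plp_cut 0.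
Proof. by have := plp_k H; rewrite /plp_cut (plp_al0 H) (plp_be0 H); case: k. Qed.

(** The tail of the exponent [M]: outside the degenerate case, where it vanishes, the head of a
    block needs a unit to give, and every other position needs room to receive one. *)
Lemma tail_exponents : exists2 t : nat -> nat,
  forall l, k <= l < n -> ~~ degenerate && plp_cut l <= t l <= b l.+1 - ~~ plp_cut l
  & \sum_(k <= l < n) t l = d - be k.
Proof.
have := plp_k H => /andP[k0 kn].
have bpos := plp_b H.
apply: sum_nat_between => [l lkn|].
  by have := bpos l lkn; case: (plp_cut l); case: degenerate => /=; lia.
have sumb : \sum_(k <= l < n) (b l.+1 - ~~ plp_cut l) + tail_rank = btail k.
  have : \sum_(k <= l < n) (b l.+1 - ~~ plp_cut l) + \sum_(k <= l < n) 1 =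
      btail k + \sum_(k <= l < n) plp_cut l.
    rewrite -!big_split /= !big_nat; apply: eq_bigr => l lkn.
    by have := bpos l lkn; case: (plp_cut l) => /=; lia.
  rewrite sum_cut_tail sum_nat_const_nat muln1; have := tail_rank_le; lia.
have dle := plp_dle H; rewrite -/(btail k) in dle.
have bed := plp_bed H.
case: (boolP degenerate) => deg /=.
  rewrite big1 // leq0n /=; move: deg => /andP[_ /eqP ->]; lia.
rewrite sum_cut_tail.
have Nb : n - k <= btail k.
  have -> : n - k = \sum_(k <= l < n) 1 by rewrite sum_nat_const_nat muln1.
  by rewrite /plp_btail !big_nat; apply: leq_sum => l /bpos.
move: sumb; rewrite /plp_tail_rank (negbTE deg) /plp_slack.
by move: deg; rewrite /plp_degenerate; case: tight => /=; lia.
Qed.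

Lemma plp_size_le (K : fieldType) (ys : seq {mpoly K[n]}) :
  (forall y, y \in ys -> max_ideal y) -> weakly_regular ys (monideal up) ->
  size ys <= n - (path_rank + tail_rank + 1).
Proof.
move=> ysM regys; have := plp_k H => /andP[k0 kn].
have [t tb ts] := tail_exponents.
(* On the path the prefix sums of [M] are the maximal values [be i]; an exchange lowers them by at
   most one, and only where [al i < be i]. *)
pose M i := if i < k then be i.+1 - be i else t i.
have cumM i : i <= k -> \sum_(0 <= l < i) M l = be i.
  elim: i => [|i IH] ik; first by rewrite big_geq // (plp_be0 H).
  rewrite big_nat_recr //= IH ?(ltnW ik) // /M ik.
  by have := be_mono H (leqnSn i) ik; lia.
have cumMn : \sum_(0 <= l < n) M l = d.
  rewrite (big_cat_nat (n := k)) //=; last exact: ltnW.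
  rewrite cumM // big_nat (eq_bigr t) => [|l /andP[kl _]]; last by rewrite /M ltnNge kl.
  by rewrite -big_nat ts; have := plp_bed H; lia.
have M0 : 0 < M 0.
  by rewrite /M k0 (plp_be0 H) subn0; exact: plp_be1 H.
have cut0 := plp_cut0.
have cutnk : plp_cut k = tight by rewrite /plp_cut ltnn eqxx.
have loop1 i : i < n -> M (block_of plp_cut i) = 0 -> block_of plp_cut i = i.
  set j := block_of plp_cut i => lti Mj.
  have cj : plp_cut j := cut_block_of cut0 i.
  have ji : j <= i := block_of_le plp_cut i.
  have j0 : 0 < j by case: posnP Mj => // ->; move: M0; case: (M 0).
  have [//|ne] := eqVneq j i.
  have ncut q : j < q -> q <= i -> ~~ plp_cut q.
    by move=> jq qi; apply/negP => /block_of_max /(_ qi); rewrite -/j; lia.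
  (* On the path, [al j = be j = be j.+1] forces [al j.+1 = be j.+1], hence a cut; on the tail a cut
     with exponent zero occurs only in the degenerate case, where every position is a cut. *)
  have := ncut j.+1 (ltnSn _) ltac:(lia); case/negP.
  move: Mj; rewrite /M; case: ltnP => jk Mj.
    have eal : al j = be j by move: cj; rewrite /plp_cut jk => /eqP.
    have ebe : be j.+1 = be j by have := be_mono H (leqnSn j) jk; lia.
    have leal := al_mono H (leqnSn j) jk.
    have lebe := plp_albe H jk.
    move: jk; rewrite leq_eqVlt => /predU1P [ejk|jk]; last first.
      by rewrite /plp_cut jk; lia.
    rewrite ejk in leal ebe lebe *; rewrite cutnk /plp_tight.
    by have := al_low n d al b (leqnn k); have := low_le_be (leqnn k); lia.
  have := tb j ltac:(lia); rewrite cj Mj andbT.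
  case: (boolP degenerate) => // deg _.
  have tr : tail_rank = 0 by rewrite /plp_tail_rank deg.
  move: deg => /andP[t1 _].
  by rewrite /plp_cut tr t1; case: ifP; [lia | case: eqP; lia].
have sz := block_size_le (K := K) (cut := plp_cut) cut0 (n := n) (M := M) _ M0 loop1
  (U := up) (@plp_up_upclosed _ _ _ _ _ _ H) _ _ ysM regys.
apply: leq_trans (sz _ _ _) _; last by have := sum_cut; lia.
- exact: ltn_trans kn.
- move=> a Ha; apply/(plp_upP H); exists (mnm_of n (exchange plp_cut M a)); last exact: lepm_refl.
  have cume i (lei : i <= n) := cum_exchange cut0 M Ha lei.
  split=> [i ik|i /andP[ki lti]|].
  + have := cume i (leq_trans ik (ltnW kn)); rewrite (cumM i ik).
    have alb := plp_albe H ik.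
    case: (boolP (plp_cut i)) => ci; last first.
      suff : al i < be i by case: (_ && _) => /=; lia.
      move: ci; rewrite /plp_cut; case: ltnP => [lt ne|ki]; first by lia.
      have -> : i = k by lia.
      rewrite eqxx /plp_tight; have := low_le_be (leqnn k).
      by have := al_low n d al b (leqnn k); lia.
    have -> : (0 < i) && (0 < M (block_of plp_cut i.-1)) &&
        (i <= a (block_of plp_cut i.-1)) = false; last by lia.
    apply/negbTE/negP => /andP[/andP[i0 _] le].
    have [|e _] := Ha (block_of plp_cut i.-1) (cut_block_of cut0 _).
      by have := block_of_le plp_cut i.-1; lia.
    by have := block_of_max ci le; rewrite e; have := block_of_le plp_cut i.-1; lia.
  + have Mi : M i = t i by rewrite /M ltnNge ki.
    rewrite expo_of lti /exchange Mi.
    have := tb i; rewrite ki lti => /(_ isT).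
    have bi : 0 < b i.+1 by apply: (plp_b H); rewrite ki lti.
    case: (boolP (plp_cut i)) => ci /=; last first.
      by case: (0 < _); case: (_ == i) => /=; lia.
    rewrite (block_of_cut ci) Mi.
    by case: posnP => [->|]; case: (_ == i) => /=; lia.
  have := cume n (leqnn n); rewrite cumMn => <-.
  have ltb : block_of plp_cut n.-1 < n by have := block_of_le plp_cut n.-1; lia.
  have [_ an] := Ha _ (cut_block_of cut0 _) ltb.
  by rewrite [n <= _]leqNgt an !andbF addn0.
move=> v Mv; apply/negP => /(plp_upP H) [u [_ _ ud] /expo_lem uM].
have := cum_diff_le uM (leq0n n); rewrite ud !cum0 !addn0.
have -> : cum (mnm_of n M - U_(v))%MM n = d - 1; last by have := plp_d H; lia.
have : cum (mnm_of n M) n = d.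
  rewrite -cumMn /cum !big_nat; apply: eq_bigr => l ltl.
  by rewrite expo_of; case/andP: ltl => _ ->.
have -> : mnm_of n M = (mnm_of n M - U_(v) + U_(v))%MM.
  by rewrite submK // lep1mP mnmE -lt0n.
by rewrite addmK cumD cumU ltn_ord; lia.
Qed.

Lemma max_ideal_ideal (K : fieldType) : is_ideal (@max_ideal K n).
Proof. exact: ideal_gen_ideal. Qed.

Local Open Scope ring_scope.

Lemma max_idealP (K : fieldType) (f : {mpoly K[n]}) : max_ideal f <-> f@_0 = 0.
Proof.
split=> [|f0].
  have idZ : is_ideal (fun f : {mpoly K[n]} => f@_0 = 0).
    split=> [|g h g0 h0|c g g0]; first exact: mcoeff0.
      by rewrite mcoeffD g0 h0 addr0.
    by rewrite rmorphM /= g0 mulr0.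
  apply: (ideal_gen_sub idZ) => _ [v ->]; rewrite mcoeffX.
  by rewrite mnm1_eq0.
apply: ideal_mpoly => [|m]; first exact: max_ideal_ideal.
case: (eqVneq m 0%MM) => [->|m0 _]; first by rewrite mcoeff_msupp f0 eqxx.
have [v mv] : exists v : 'I_n, (0 < m v)%N.
  apply/existsP; apply: contraNT m0; rewrite negb_exists => /forallP z.
  by apply/eqP/mnmP => v; rewrite mnm0E; apply/eqP; rewrite eqn0Ngt.
have -> : m = (U_(v) + (m - U_(v)))%MM.
  by rewrite addmC submK // lep1mP -lt0n.
rewrite mpolyXD; apply: ideal_mulr; first exact: max_ideal_ideal.
by apply: ideal_gen_mem; exists v.
Qed.

Lemma plp_depth (K : fieldType) :
  is_depth (monideal up : {mpoly K[n]} -> Prop)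
    (n - (path_rank + tail_rank + 1)).
Proof.
have upU := @plp_up_upclosed _ _ _ _ _ _ H.
have idJ := monideal_ideal K upU.
split; last first.
  by move=> s /(regular_seqP _ _ idJ) [sM regs _]; apply: plp_size_le.
have := sum_cut; set c := (path_rank + tail_rank)%N => sumc.
set r := (n - (c + 1))%N.
exists (esyms K n r); first by rewrite size_map size_iota.
apply/(regular_seqP _ _ idJ).
have esM f : f \in esyms K n r -> max_ideal f.
  move=> /mapP [i]; rewrite mem_iota => /andP[i0 _] ->; apply/max_idealP.
  apply: memN_msupp_eq0; apply/negP => /mesym_homogeneous.
  by rewrite mdeg0; lia.
split=> //.
  apply: prime_filtered_regular (plp_prime_filtered H) upU.
  by rewrite -/c /r; lia.
have JM (f : {mpoly K[n]}) : monideal up f -> max_ideal f.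
  move=> Jf; apply/max_idealP/memN_msupp_eq0/negP.
  move=> /Jf /(plp_upP H) [u [_ _ ud] /expo_lem u0].
  have := cum_diff_le u0 (leq0n n); rewrite ud !cum0 !addn0 cum_mdeg mdeg0.
  by have := plp_d H; lia.
move=> /(ideal_adds_sub (max_ideal_ideal K) JM esM) /max_idealP.
by rewrite mcoeff1 eqxx => /eqP; rewrite oner_eq0.
Qed.

End Depth.

(** * Associated primes of a PLP ideal *)

Section AssociatedPrimes.
Variables (n k d : nat) (al be b : nat -> nat).
Hypothesis H : plp n k d al be b.
Implicit Types (w u m : 'X_{1..n}) (F : {set 'I_n}) (v : 'I_n) (A : pred nat).

Notation low := (plp_low n k d al b).
Notation btail := (plp_btail n b).
Notation wtail := (plp_wtail k b).
Notation up := (plp_up k d al be b).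
Notation slack := (plp_slack n k d be b).

(** [F] is the set of variables of the inequality [low i + cum w j <= be j + cum w i]. The
    conditions on [p] make it possible that this inequality fails by one while any single variable
    of [F] repairs the whole system. *)
Definition path_type F := exists j i, [/\ j < i <= k,
  forall v, (v \in F) = (j <= v < i), be j < low i
  & forall p, j < p < i -> [/\ al p < be p, be j < be p & al p < low i]].

Definition btail_off A := \sum_(k <= l < n | ~~ A l) b l.+1.
Definition tail_card A := \sum_(k <= l < n) A l.

(** The analogue for [d + cum w j <= be j + cum w k + plp_wtail w], with [A] the tail variables
    still below their bounds. The upper bound on [tail_card A] is stated separately, because it
    alone changes when the data are scaled. *)
Definition tail_type F j A := [/\ j <= k, 0 < tail_card A,
  forall v, (v \in F) = (j <= v < k) || ((k <= v) && A v),
  be j + btail_off A < d /\ (j < k -> low k + btail_off A < d)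
  & forall p, j < p <= k -> low p < be p /\ be j < be p].

Let low_be i (ik : i <= k) := low_le_be H ik.

Lemma low_le_d i : i <= k -> low i <= d.
Proof.
move=> ik; apply: leq_trans (low_be ik) _.
exact: leq_trans (be_mono H ik (leqnn k)) (plp_bed H).
Qed.

Lemma b_le_btail l : k <= l < n -> b l.+1 <= btail k.
Proof.
move=> kl; rewrite /plp_btail (bigD1_seq l) ?iota_uniq ?mem_index_iota //=.
exact: leq_addr.
Qed.

Lemma wtailU w v : wtail (w + U_(v))%MM = wtail w + ((k <= v) && (w v < b v.+1)).
Proof.
rewrite /plp_wtail; case: (leqP k v) => kv; last first.
  rewrite addn0 !big_nat; apply: eq_bigr => l kl.
  by rewrite expoD expoU; case: eqP => [e|]; [lia | rewrite addn0].
have mem : (v : nat) \in index_iota k n by rewrite mem_index_iota kv ltn_ord.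
rewrite !(bigD1_seq (v : nat)) ?iota_uniq //= expoD expoU eqxx expoE.
rewrite (eq_bigr (fun l => minn (expo w l) (b l.+1))) => [|l ne].
  by case: ltnP; lia.
by rewrite expoD expoU (negbTE ne) addn0.
Qed.

Lemma plp_up_violated w : ~~ up w ->
  (exists j i, [/\ j <= i, i <= k & be j + cum w i < low i + cum w j]) \/
  (forall j i, j <= i -> i <= k -> low i + cum w j <= be j + cum w i) /\
  (exists2 j, j <= k & be j + cum w k + wtail w < d + cum w j).
Proof.
move=> nU.
case: (Classical_Prop.classic (exists j i,
  [/\ j <= i, i <= k & be j + cum w i < low i + cum w j])) => [|n1]; first by left.
have I1 j i : j <= i -> i <= k -> low i + cum w j <= be j + cum w i.
  by move=> ji ik; rewrite leqNgt; apply/negP => lt; apply: n1; exists j, i.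
right; split=> //; apply: Classical_Prop.NNPP => n2.
case/negP: nU; apply/(plp_up_ineq H); split=> // j jk.
by rewrite leqNgt; apply/negP => lt; apply: n2; exists j.
Qed.

Lemma sum_split_pred A (f : nat -> nat) :
  \sum_(k <= l < n) f l = \sum_(k <= l < n | A l) f l + \sum_(k <= l < n | ~~ A l) f l.
Proof. exact: bigID. Qed.

(** After multiplication by a high power of the variables outside [F], some inequality still fails.
    Large exponents cannot occur in it and every variable of [F] must repair it, so [F] is exactly
    its set of variables and it fails by one. The other inequalities, valid after multiplication by
    any variable of [F], give the remaining conditions. *)
Lemma mon_assoc_type F : mon_assoc up F ->
  path_type F \/ exists j A, tail_type F j A /\ tail_card A <= slack + (j == k).
Proof.
move=> [w0 [_ UF0 nU0]]; have := plp_k H => /andP[k0 kn].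
pose Bg := d + btail k.
pose far : 'X_{1..n} := [multinom if v \in F then 0 else Bg | v < n].
pose w := (w0 + far)%MM.
have nfar : ~~ meets F far.
  by apply/negP => /meetsP [v vF]; rewrite mnmE vF.
have {nU0 nfar} nU : ~~ up w by apply: nU0.
have {}UF v : v \in F -> up (w + U_(v))%MM.
  move=> /UF0 U0; apply: (plp_up_upclosed H) U0 _; apply/mnm_lepP => l.
  by rewrite !mnmDE; lia.
have big v : v \notin F -> Bg <= expo w v.
  by move=> /negbTE vF; rewrite expoE mnmDE mnmE vF leq_addl.
have bigcum (j i : nat) v : v \notin F -> j <= v -> v < i -> Bg + cum w j <= cum w i.
  move=> vF jv vi; have := cum_le w jv; have := cum_le w vi.
  by rewrite cumS; have := big v vF; lia.
have I1F v j i : v \in F -> j <= i -> i <= k ->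
    low i + cum w j + (v < j) <= be j + cum w i + (v < i).
  move=> /UF /(plp_up_ineq H) [I1 _] ji ik; have := I1 j i ji ik.
  by rewrite !cumD !cumU; lia.
have I2F v j : v \in F -> j <= k -> d + cum w j + (v < j) <=
    be j + cum w k + (v < k) + (wtail w + ((k <= v) && (w v < b v.+1))).
  move=> /UF /(plp_up_ineq H) [_ I2] jk; have := I2 j jk.
  by rewrite !cumD !cumU wtailU; lia.
case: (plp_up_violated nU) => [[j [i [ji ik lt]]]|[I1 [j jk lt]]].
  have {}ji : j < i.
    by move: ji lt; rewrite leq_eqVlt => /predU1P [->|//]; have := low_be ik; lia.
  have Fji v : (v \in F) = (j <= v < i).
    apply/idP/idP => [vF|/andP[jv vi]]; first by have := I1F v j i vF (ltnW ji) ik; lia.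
    apply: contraT => vF; have := bigcum j i v vF jv vi.
    by have := low_le_d ik; rewrite /Bg; lia.
  have jn : j < n by lia.
  have jF : Ordinal jn \in F by rewrite Fji /= leqnn.
  have ex := I1F _ j i jF (ltnW ji) ik; rewrite /= in ex.
  left; exists j, i; split=> //; first by rewrite ji.
    by have := cum_le w (ltnW ji); lia.
  move=> p /andP[jp pi].
  have pn : p < n by lia.
  have pF : Ordinal pn \in F by rewrite Fji /= pi ltnW.
  have := I1F _ j p pF (ltnW jp) ltac:(lia).
  have := I1F _ p i jF (ltnW pi) ik; rewrite /=.
  have := cum_le w (ltnW jp); have := cum_le w (ltnW pi).
  by have := al_low n d al b (i := p) (k := k) ltac:(lia); split; lia.
pose A l := expo w l < b l.+1.
have Fv v : (v \in F) = (j <= v < k) || ((k <= v) && A v).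
  apply/idP/idP => [vF|].
    by have := I2F v j vF jk; rewrite /A expoE; case: (_ < b _) => /=; lia.
  apply: contraTT => vF; have := big v vF; rewrite negb_or /A => Bgw.
  apply/andP; split.
    by apply/negP => /andP[jv vk]; have := bigcum j k v vF jv vk; rewrite /Bg; lia.
  apply/negP => /andP[kv]; have := b_le_btail (l := v).
  by rewrite kv ltn_ord => /(_ isT); rewrite /Bg in Bgw; lia.
have wtE : wtail w = \sum_(k <= l < n | A l) expo w l + btail_off A.
  rewrite /plp_wtail (sum_split_pred A); congr (_ + _); apply: eq_bigr => l; rewrite /A; lia.
have bE : btail k = \sum_(k <= l < n | A l) b l.+1 + btail_off A.
  exact: sum_split_pred.
have cardA : tail_card A + \sum_(k <= l < n | A l) expo w l <= \sum_(k <= l < n | A l) b l.+1.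
  rewrite /tail_card big_mkcond [X in _ + X]big_mkcond [X in _ <= X]big_mkcond -big_split /=.
  by apply: leq_sum => l _; rewrite /A; case: ltnP => //=; lia.
have A0 : 0 < tail_card A.
  rewrite lt0n; apply/negP => /eqP c0.
  have nA l : k <= l < n -> A l = false.
    move=> kl; apply/negbTE/negP => Al; move: c0; rewrite /tail_card.
    by rewrite (bigD1_seq l) ?iota_uniq ?mem_index_iota //= Al.
  have : btail_off A = btail k.
    rewrite /btail_off big_mkcond /plp_btail !big_nat; apply: eq_bigr => l kl.
    by rewrite nA.
  have := I1 j k jk (leqnn k); have := low_k n k d al b; lia.
have [v vF] : exists v, v \in F.
  apply: Classical_Prop.NNPP => nF; move: A0; rewrite lt0n => /negP; apply.
  rewrite /tail_card big_nat big1 // => l /andP[kl ln].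
  case: (boolP (A l)) => // Al; case: nF; exists (Ordinal ln).
  by rewrite Fv /= kl Al orbT.
have ex := I2F v j vF jk; have {}ex : be j + cum w k + wtail w + 1 = d + cum w j.
  by move: ex; rewrite leq_eqVlt; case: (_ < b _) => /=; lia.
have ckj := cum_le w jk.
have P p : j < p <= k -> be j + cum w p + 1 <= be p + cum w j.
  move=> /andP[jp pk]; have jn : j < n by lia.
  have jF : Ordinal jn \in F by rewrite Fv /= leqnn /=; apply/orP; left; lia.
  have := I2F _ p jF pk; rewrite /= jp (_ : j < k); last by lia.
  by rewrite (_ : k <= j = false) /=; lia.
right; exists j, A; split; last first.
  (* Each variable of [A] misses at least one unit of its bound, so the exact failure by one limits
     the size of [A]; for [j < k] the inequality [P k] costs one more unit. *)
  case: eqP => [e|ne]; first by rewrite e /plp_slack in ex *; lia.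
  by have := P k ltac:(lia); rewrite /plp_slack; lia.
split=> //.
  split; first by lia.
  by move=> jk'; have := I1 j k jk (leqnn k); lia.
move=> p jp; have := P p jp; have := I1 j p ltac:(lia) ltac:(lia).
by have := cum_le w (i := j) (j := p) ltac:(lia); lia.
Qed.

Let Bg := d + btail k.

(* The witness attached to a path s_j <= ... <= s_i, to the values t on the   *)
(* tail part A, and to large exponents elsewhere.                             *)
Definition assoc_witness j i (s t : nat -> nat) A : 'X_{1..n} :=
  mnm_of n (fun l => if j <= l < i then s l.+1 - s l
                     else if (k <= l) && A l then t l else Bg).

Lemma cum_witness j i s t A p : i <= k ->
  (forall p q, j <= p -> p <= q -> q <= i -> s p <= s q) -> j <= p <= i ->
  cum (assoc_witness j i s t A) p + s j = cum (assoc_witness j i s t A) j + s p.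
Proof.
move=> ik mono; have := plp_k H => /andP[k0 kn].
elim: p => [|p IH] jp; first by have -> : j = 0 by lia.
have [->|ne] := eqVneq j p.+1; first by [].
rewrite cumS expo_of (_ : p < n); last by lia.
rewrite (_ : j <= p < i); last by lia.
have := IH ltac:(lia); have := mono p p.+1 ltac:(lia) (leqnSn p) ltac:(lia).
by have := mono j p (leqnn j) ltac:(lia) ltac:(lia); lia.
Qed.

Lemma witness_big j i s t A w p q : i <= k -> p <= q -> q <= k ->
  (p < j /\ p < q) \/ (i < q /\ p < q) ->
  Bg + cum (assoc_witness j i s t A + w)%MM p <= cum (assoc_witness j i s t A + w)%MM q.
Proof.
move=> ik pq qk out; have := plp_k H => /andP[k0 kn].
have [l [pl lq lout]] : exists l, [/\ p <= l, l < q & ~~ (j <= l < i)].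
  by case: out => [[pj ltpq]|[iq ltpq]]; [exists p | exists q.-1]; split; lia.
have := cum_le (assoc_witness j i s t A + w)%MM pl.
have := cum_le (assoc_witness j i s t A + w)%MM lq.
rewrite cumS expoD expo_of (_ : l < n); last by lia.
rewrite (negbTE lout) (_ : k <= l = false) /=; lia.
Qed.

Lemma wtail_witness j i s t A : i <= k ->
  (forall l, k <= l < n -> A l -> t l < b l.+1) ->
  wtail (assoc_witness j i s t A) =
    \sum_(k <= l < n | A l) t l + btail_off A.
Proof.
move=> ik tb; rewrite /plp_wtail (sum_split_pred A); congr (_ + _).
  rewrite big_nat_cond [RHS]big_nat_cond; apply: eq_bigr => l /andP[kl Al].
  rewrite expo_of; have := tb l kl Al; case/andP: kl => kl ->.
  by rewrite (_ : (j <= l < i) = false) ?kl ?Al /=; lia.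
rewrite /btail_off big_nat_cond [RHS]big_nat_cond; apply: eq_bigr => l /andP[kl nA].
rewrite expo_of; have := b_le_btail kl; case/andP: kl => kl ->.
by rewrite (_ : (j <= l < i) = false) ?kl ?(negbTE nA) /= /Bg; lia.
Qed.

Lemma not_meets_expo F w (A : pred nat) :
  ~~ meets F w -> (forall v, (v \in F) = A v) ->
  forall l, A l -> expo w l = 0.
Proof.
move=> nm FA l Al; case: (ltnP l n) => ln; last exact: expo_out.
rewrite -[l]/(val (Ordinal ln)) expoE; apply/eqP; rewrite eqn0Ngt.
by apply: contra nm => lt; apply/meetsP; exists (Ordinal ln); rewrite ?FA.
Qed.

Lemma mon_assoc_intro F w : (forall v, v \in F -> up (w + U_(v))%MM) ->
  (forall w', ~~ meets F w' -> ~~ up (w + w')%MM) -> mon_assoc up F.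
Proof.
by move=> UF nU; exists w; split=> //; have := nU 0%MM; rewrite meets0 addm0; apply.
Qed.

Lemma path_type_mon_assoc F : path_type F -> mon_assoc up F.
Proof.
move=> [j [i [/andP[ji ik] FE bl cond]]]; have := plp_k H => /andP[k0 kn].
(* Prefix sums counted from [be j]: they stop one short of [low i] and in between are as small as
   [al] and monotonicity allow, hence strictly below [be]. *)
pose s p := if p == j then be j else if p == i then low i - 1 else maxn (al p) (be j).
pose w := assoc_witness j i s (fun=> 0) pred0.
have mono p q : j <= p -> p <= q -> q <= i -> s p <= s q.
  rewrite leq_eqVlt => /predU1P [<-|jp]; rewrite leq_eqVlt => /predU1P [->//|pq] qi.
    by rewrite /s eqxx; case: eqP => [|_]; [lia|case: eqP; lia].
  have [? ? ?] := cond p ltac:(lia); have := al_mono H (ltnW pq) (leq_trans qi ik).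
  by rewrite /s; do !case: eqP; lia.
have cw p (jp : j <= p <= i) := @cum_witness j i s (fun=> 0) pred0 p ik mono jp.
rewrite -/w in cw.
have sj : s j = be j by rewrite /s eqxx.
have si : s i = low i - 1 by rewrite /s eqxx; case: eqP => //; lia.
apply: (@mon_assoc_intro _ w) => [v vF|w' nm]; last first.
  apply/negP => /(plp_up_ineq H) [I1 _]; have := I1 j i (ltnW ji) ik.
  have w0 l (jl : j <= l < i) := not_meets_expo (A := fun l => j <= l < i) nm FE jl.
  have : cum w' i = cum w' j.
    have := @cum_eq n w' 0%MM j i (ltnW ji) _.
    have c0 l : cum (0%MM : 'X_{1..n}) l = 0.
      by rewrite /cum big1 // => x _; case: (ltnP x n) => xn;
         [rewrite -[x]/(val (Ordinal xn)) expoE mnm0E | rewrite expo_out].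
    rewrite !c0 addn0 add0n; apply => l jl; rewrite w0 //.
    by have := cumS (0%MM : 'X_{1..n}) l; rewrite !c0.
  by rewrite !cumD; have := cw i ltac:(lia); lia.
rewrite FE in vF.
have I1 j' i' : j' <= i' -> i' <= k ->
    low i' + cum (w + U_(v))%MM j' <= be j' + cum (w + U_(v))%MM i'.
  move=> ji' ik'.
  have big : (j' < j /\ j' < i') \/ (i < i' /\ j' < i') ->
      low i' + cum (w + U_(v))%MM j' <= be j' + cum (w + U_(v))%MM i'.
    move=> /(@witness_big j i s (fun=> 0) pred0 U_(v)%MM j' i' ik ji' ik').
    by rewrite -/w /Bg; have := low_le_d ik'; lia.
  have [->|ne] := eqVneq j' i'; first by have := low_be ik'; lia.
  case: (ltnP j' j) => jj'; first by apply: big; left; lia.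
  case: (ltnP i i') => ii'; first by apply: big; right; lia.
  rewrite !cumD !cumU.
  have := cw j' ltac:(lia); have := cw i' ltac:(lia).
  have sj' : s j' + (j < j') <= be j'.
    rewrite /s; case: eqP => [->|nj]; first by rewrite ltnn addn0.
    have := cond j'; case: (eqVneq j' i) => [->|ne' c]; first by have := low_be ik; lia.
    by have [? ? ?] := c ltac:(lia); lia.
  have : low i' <= s i' + (i' == i).
    rewrite /s (_ : (i' == j) = false); last by lia.
    by case: (eqVneq i' i) => [->|ni]; [lia | rewrite low_al; lia].
  by case: (eqVneq i' i) => [->|]; lia.
apply/(plp_up_ineq H); split=> // j' jk'.
have : btail k <= wtail (w + U_(v))%MM.
  rewrite wtailU (wtail_witness (t := fun=> 0) _ _ ik) //.
  by rewrite big_pred0 // /btail_off /plp_btail /=; lia.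
by have := I1 j' k jk' (leqnn k); have := low_k n k d al b; lia.
Qed.

Lemma tail_type_mon_assoc F j A : tail_type F j A ->
  tail_card A <= slack + (j == k) -> mon_assoc up F.
Proof.
move=> [jk A0 FE [bd lowd] cond] cA; have := plp_k H => /andP[k0 kn].
(* After [j] the path stays one below [be], and low enough that the tail variables outside [A] do
   not complete the degree. *)
pose s p := if p == j then be j else minn (be p - 1) (d - btail_off A - 1).
have bed := plp_bed H.
have dle := plp_dle H; rewrite -/(btail k) in dle.
have bE : btail k = \sum_(k <= l < n | A l) b l.+1 + btail_off A.
  exact: sum_split_pred.
have bpos := plp_b H.
have mono p q : j <= p -> p <= q -> q <= k -> s p <= s q.
  rewrite leq_eqVlt => /predU1P [<-|jp]; rewrite leq_eqVlt => /predU1P [->//|pq] qk.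
    by rewrite /s eqxx; have := cond q ltac:(lia); case: eqP; lia.
  by have := be_mono H (ltnW pq) qk; rewrite /s; do !case: eqP; lia.
have sumb : \sum_(k <= l < n) (if A l then b l.+1 - 1 else 0) + tail_card A =
    \sum_(k <= l < n | A l) b l.+1.
  rewrite [RHS]big_mkcond /tail_card -big_split /= !big_nat; apply: eq_bigr => l kl.
  by have := bpos l kl; case: (A l); lia.
(* The bound on [tail_card A] is exactly what lets the remaining degree, less one, fit into [A] with
   every exponent below its bound. *)
have sk : d - btail_off A - 1 - s k <= \sum_(k <= l < n) (if A l then b l.+1 - 1 else 0).
  rewrite /s [k == j]eq_sym; rewrite /plp_slack in cA.
  by case: eqP cA => [->|ne] cA; lia.
have skd : s k + btail_off A < d.
  by rewrite /s; case: eqP => [e|ne]; lia.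
have [||t tb ts] := @sum_nat_between (fun=> 0) (fun l => if A l then b l.+1 - 1 else 0)
    k n (d - btail_off A - 1 - s k).
- by [].
- by rewrite big1.
pose w := assoc_witness j k s t A.
have cw p (jp : j <= p <= k) := @cum_witness j k s t A p (leqnn k) mono jp.
rewrite -/w in cw.
have sj : s j = be j by rewrite /s eqxx.
have tA l : k <= l < n -> A l -> t l < b l.+1.
  by move=> kl Al; have := tb l kl; have := bpos l kl; rewrite Al; lia.
have wt : s k + wtail w + 1 = d.
  rewrite wtail_witness //.
  have -> : \sum_(k <= l < n | A l) t l = \sum_(k <= l < n) t l.
    rewrite big_mkcond !big_nat; apply: eq_bigr => l kl.
    by have := tb l kl; case: (A l) => //=; lia.
  by rewrite ts; lia.
apply: (@mon_assoc_intro _ w) => [v vF|w' nm]; last first.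
  apply/negP => /(plp_up_ineq H) [_ I2]; have := I2 j jk.
  have w0 l := not_meets_expo (A := fun l => (j <= l < k) || (k <= l) && A l) nm FE (l := l).
  have cw' : cum w' k = cum w' j.
    have : forall p, j <= p <= k -> cum w' p = cum w' j.
      elim=> [|p IH] jp; first by have -> : j = 0 by lia.
      have [->//|ne] := eqVneq j p.+1.
      by rewrite cumS IH ?w0; lia.
    by apply; rewrite jk leqnn.
  have -> : wtail (w + w')%MM = wtail w.
    rewrite /plp_wtail !big_nat; apply: eq_bigr => l kl; rewrite expoD.
    case: (boolP (A l)) => Al; first by rewrite w0 ?addn0 // Al; case/andP: kl => ->; rewrite orbT.
    have : b l.+1 <= expo w l; last by lia.
    rewrite expo_of; have := b_le_btail kl; case/andP: kl => kl ->.
    by rewrite (_ : (j <= l < k) = false) ?kl ?(negbTE Al) /= /Bg; lia.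
  by rewrite !cumD; have := cw k ltac:(lia); lia.
rewrite FE in vF; apply/(plp_up_ineq H); split=> [j' i' ji' ik'|j' jk'].
  have [->|ne] := eqVneq j' i'; first by have := low_be ik'; lia.
  case: (ltnP j' j) => jj'.
    have := @witness_big j k s t A U_(v)%MM j' i' (leqnn k) ji' ik' ltac:(left; lia).
    by rewrite -/w /Bg; have := low_le_d ik'; lia.
  rewrite !cumD !cumU.
  have := cw j' ltac:(lia); have := cw i' ltac:(lia).
  have sj' : s j' <= be j' by rewrite /s; case: eqP => [->|nj]; lia.
  have := cond i' ltac:(lia).
  have : low i' + btail_off A < d.
    have := lowd ltac:(lia); case: (ltnP i' k) => ik; last by have -> : i' = k by lia.
    rewrite (low_al _ _ _ _ ik).
    by have := al_mono H ik' (leqnn k); have := al_low n d al b (leqnn k); lia.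
  by have : s i' = minn (be i' - 1) (d - btail_off A - 1); [rewrite /s; case: eqP; lia | lia].
case: (ltnP j' j) => jj'.
  have := @witness_big j k s t A U_(v)%MM j' k (leqnn k) jk' (leqnn k) ltac:(left; lia).
  by rewrite -/w /Bg; lia.
rewrite wtailU !cumD !cumU.
have := cw j' ltac:(lia); have := cw k ltac:(lia).
have sj' : s j' + (j < j') <= be j'.
  by rewrite /s; case: eqP => [->|nj]; [lia | have := cond j' ltac:(lia); lia].
have vtb : k <= v -> w v < b v.+1.
  move=> kv; have Av : A v by move: vF; rewrite kv /=; lia.
  have kvn : k <= v < n by rewrite kv ltn_ord.
  rewrite -expoE expo_of ltn_ord (_ : (j <= v < k) = false) ?kv ?Av /=; last by lia.
  exact: tA.
by case: (leqP k v) vtb vF => [kv /(_ isT) ->|vk _] /=; lia.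
Qed.

End AssociatedPrimes.

(** * Powers *)

(** Hermite's identity; raising [x] by one replaces the summand [x %/ m] by [(x + m) %/ m]. *)
Lemma sum_divn_shift m x : 0 < m -> \sum_(0 <= r < m) (x + r) %/ m = x.
Proof.
move=> m0; elim: x => [|x IH].
  by rewrite big_nat big1 // => r /andP[_ lt]; rewrite add0n divn_small.
have : \sum_(0 <= r < m) (x + r) %/ m + (x + m) %/ m =
    x %/ m + \sum_(0 <= r < m) (x.+1 + r) %/ m.
  rewrite -big_nat_recr //= big_nat_recl //= addn0; congr (_ + _).
  by apply: eq_bigr => r _; rewrite addnS addSn.
by rewrite IH divnDr // divnn m0; lia.
Qed.

Section Powers.
Variables (n k d : nat) (al be b : nat -> nat).
Hypothesis H : plp n k d al be b.
Implicit Types (w u : 'X_{1..n}).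

Definition scaled_base m u :=
  plp_base k (m * d) (fun i => m * al i) (fun i => m * be i) (fun i => m * b i) u.

Lemma plp_scaled m : 0 < m ->
  plp n k (m * d) (fun i => m * al i) (fun i => m * be i) (fun i => m * b i).
Proof.
move=> m0; case: H => kn d0 a0 b0 ab am bm b1 bd bp dle; split=> //.
- by rewrite muln_gt0 m0.
- by rewrite a0 muln0.
- by rewrite b0 muln0.
- by move=> i /ab; rewrite leq_pmul2l.
- by move=> i j /am; rewrite leq_pmul2l.
- by move=> i j /bm; rewrite leq_pmul2l.
- by rewrite muln_gt0 m0.
- by rewrite leq_pmul2l.
- by move=> j /bp; rewrite muln_gt0 m0.
- by rewrite -big_distrr -mulnDr leq_pmul2l.
Qed.

Lemma scaled_base_add m u u' :
  scaled_base m u -> scaled_base 1 u' -> scaled_base m.+1 (u + u')%MM.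
Proof.
move=> [ual ub ud] [ual' ub' ud']; split=> [i ik|j kj|].
- by rewrite cumD; have := ual i ik; have := ual' i ik; lia.
- by rewrite expoD; have := ub j kj; have := ub' j kj; lia.
by rewrite cumD ud ud'; lia.
Qed.

Lemma scaled_base0 : scaled_base 0 0%MM.
Proof.
have e0 i : expo (0%MM : 'X_{1..n}) i = 0.
  case: (ltnP i n) => lt; last exact: expo_out.
  by rewrite -[i]/(val (Ordinal lt)) expoE mnm0E.
have c0 i : cum (0%MM : 'X_{1..n}) i = 0 by rewrite /cum big1.
by split=> [i _|j _|]; rewrite ?c0 ?e0.
Qed.

(** Rounding the prefix sums of [u / m] with offset [r]. Prefix bounds and bounds on single
    exponents both survive rounding, and by Hermite's identity the [m] parts add up to [u]. *)
Definition base_part m u r : 'X_{1..n} :=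
  mnm_of n (fun i => (cum u i.+1 + r) %/ m - (cum u i + r) %/ m).

Lemma cum_base_part m u r i : r < m -> i <= n ->
  cum (base_part m u r) i = (cum u i + r) %/ m.
Proof.
move=> rm; elim: i => [|i IH] lei; first by rewrite !cum0 add0n divn_small.
rewrite cumS expo_of lei IH ?(ltnW lei) // addnC subnK //.
by apply: leq_div2r; rewrite leq_add2r; apply: cum_le.
Qed.

Lemma base_part_base m u r : r < m -> scaled_base m u ->
  plp_base k d al be b (base_part m u r).
Proof.
move=> rm [ual ub ud]; have m0 : 0 < m by lia.
have := plp_k H => /andP[k0 kn].
split=> [i ik|j /andP[kj jn]|].
- rewrite cum_base_part ?(leq_trans ik (ltnW kn)) //.
  have := ual i ik => /andP[lo hi]; apply/andP; split.
    by rewrite leq_divRL // mulnC; lia.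
  by rewrite -ltnS ltn_divLR // mulnC mulnS; lia.
- rewrite expo_of jn cumS leq_subLR.
  apply: leq_trans (_ : (cum u j + r + b j.+1 * m) %/ m <= _).
    by apply: leq_div2r; have := ub j; rewrite kj jn => /(_ isT); rewrite mulnC; lia.
  by rewrite divnDMl.
by rewrite cum_base_part // ud mulnC divnMDl // divn_small // addn0.
Qed.

Lemma sum_base_part m u : 0 < m -> u = (\sum_(r < m) base_part m u r)%MM.
Proof.
move=> m0; apply/mnmP => v; rewrite mnm_sumE.
have ev := cumS u v; rewrite expoE in ev.
suff : \sum_(r < m) (base_part m u r) v + cum u v = cum u v.+1.
  by rewrite ev addnC => /addnI.
rewrite -{1}(sum_divn_shift (cum u v) m0) -(sum_divn_shift (cum u v.+1) m0).
rewrite !big_mkord -big_split /=; apply: eq_bigr => r _.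
have lv := ltn_ord v; have lr := ltn_ord r.
have := cumS (base_part m u r) v; rewrite !cum_base_part ?(ltnW lv) // expoE.
lia.
Qed.

Variable K : fieldType.
Local Open Scope ring_scope.

Definition base_ideal : {mpoly K[n]} -> Prop :=
  ideal_gen (fun f => exists2 u : 'X_{1..n}, plp_base k d al be b u & f = 'X_[u]).

Lemma base_ideal_supp f : base_ideal f ->
  forall w, w \in msupp f -> exists2 u, plp_base k d al be b u & (u <= w)%MM.
Proof.
move=> If w wf; apply/(plp_upP H).
have idJ := monideal_ideal K (plp_up_upclosed H).
apply: (ideal_gen_sub idJ _ If) wf => _ [u bu ->]; apply/monidealX/(plp_upP H).
by exists u => //; apply: lepm_refl.
Qed.

Lemma base_ideal_exp m f : (0 < m)%N ->
  ideal_exp base_ideal m f <->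
  monideal (plp_up k (m * d) (fun i => m * al i)%N (fun i => m * be i)%N
    (fun i => m * b i)%N) f.
Proof.
move=> m0; have Hm := plp_scaled m0.
have idJ := monideal_ideal K (plp_up_upclosed Hm).
split.
  apply: (ideal_gen_sub idJ) => _ [g [Ig ->]] w wg; apply/(plp_upP Hm).
  elim: (m) g Ig w wg => [|m' IH] g Ig w.
    rewrite big_ord0 msupp1 inE => /eqP ->.
    by exists 0%MM; [exact: scaled_base0 | exact: lepm_refl].
  rewrite big_ord_recr /= => /msuppM_le /allpairsP [[w1 w2] /= [w1g w2g ->]].
  have [u1 bu1 /expo_lem uw1] := IH _ (fun i => Ig _) _ w1g.
  have [u2 bu2 /expo_lem uw2] := base_ideal_supp (Ig _) w2g.
  exists (u1 + u2)%MM.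
    apply: scaled_base_add => //; case: bu2 => ? ? ?.
    by split=> *; rewrite ?mul1n; auto.
  by apply/expo_lem => i; rewrite !expoD leq_add.
move=> Jf; have idE : is_ideal (ideal_exp base_ideal m) by apply: ideal_gen_ideal.
apply: ideal_mpoly => // w /Jf /(plp_upP Hm) [u bu uw].
rewrite -(submK uw) mpolyXD; apply: ideal_mull => //.
apply: ideal_gen_mem; exists (fun r : 'I_m => 'X_[base_part m u r]); split.
  move=> r; apply: ideal_gen_mem; exists (base_part m u r) => //.
  exact: base_part_base.
rewrite {1}(sum_base_part u m0).
by elim/big_rec2: _ => [|r p q _ <-]; rewrite ?mpolyX0 ?mpolyXD.
Qed.

End Powers.

(** * Behaviour of the invariants under scaling *)

Section Scaling.
Variables (n k d : nat) (al be b : nat -> nat).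
Hypothesis H : plp n k d al be b.
Variable m : nat.
Hypothesis m_gt0 : 0 < m.

Notation al' := (fun i => m * al i).
Notation be' := (fun i => m * be i).
Notation b' := (fun i => m * b i).

Lemma btail_scaled i : plp_btail n b' i = m * plp_btail n b i.
Proof. by rewrite /plp_btail big_distrr. Qed.

Lemma low_scaled i : plp_low n k (m * d) al' b' i = m * plp_low n k d al b i.
Proof.
rewrite /plp_low btail_scaled -mulnBr maxnMr.
by case: ifP; case: ifP; rewrite ?muln0.
Qed.

Lemma slack_scaled : plp_slack n k (m * d) be' b' = m * plp_slack n k d be b.
Proof. by rewrite /plp_slack btail_scaled mulnBr mulnDr. Qed.

Lemma tight_scaled : plp_tight n k (m * d) al' be' b' = plp_tight n k d al be b.
Proof. by rewrite /plp_tight low_scaled eqn_pmul2l. Qed.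

Lemma degenerate_scaled :
  plp_degenerate n k (m * d) al' be' b' = plp_degenerate n k d al be b.
Proof. by rewrite /plp_degenerate tight_scaled eqn_pmul2l. Qed.

Lemma path_rank_scaled i : plp_path_rank al' be' i = plp_path_rank al be i.
Proof. by apply: eq_bigr => q _; rewrite ltn_pmul2l. Qed.

Lemma path_type_scaled (F : {set 'I_n}) :
  path_type k (m * d) al' be' b' F <-> path_type k d al be b F.
Proof.
split=> -[j [i [ji FE bl cond]]]; exists j, i; split=> //.
- by move: bl; rewrite low_scaled ltn_pmul2l.
- by move=> p /cond; rewrite low_scaled !ltn_pmul2l.
- by rewrite low_scaled ltn_pmul2l.
- by move=> p /cond; rewrite low_scaled !ltn_pmul2l.
Qed.

Lemma tail_type_scaled (F : {set 'I_n}) j A :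
  tail_type k (m * d) al' be' b' F j A <-> tail_type k d al be b F j A.
Proof.
have off : btail_off n k b' A = m * btail_off n k b A by rewrite /btail_off big_distrr.
split=> -[jk A0 FE [bd ld] cond]; split=> //.
- by move: bd ld; rewrite off low_scaled -!mulnDr !ltn_pmul2l.
- by move=> p /cond; rewrite low_scaled !ltn_pmul2l.
- by rewrite off low_scaled -!mulnDr !ltn_pmul2l.
- by move=> p /cond; rewrite low_scaled !ltn_pmul2l.
Qed.

Lemma mon_assoc_scaled (F : {set 'I_n}) :
  mon_assoc (plp_up k (m * d) al' be' b') F <->
  path_type k d al be b F \/
  exists j A, tail_type k d al be b F j A /\
    tail_card n k A <= m * plp_slack n k d be b + (j == k).
Proof.
have Hm := plp_scaled H m_gt0; split.
  case/(mon_assoc_type Hm) => [/path_type_scaled|[j [A [/tail_type_scaled tF]]]]; first by left.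
  by rewrite slack_scaled => cA; right; exists j, A.
case=> [/path_type_scaled/(path_type_mon_assoc Hm)//|[j [A [/tail_type_scaled tF cA]]]].
by apply: (tail_type_mon_assoc Hm tF); rewrite slack_scaled.
Qed.

End Scaling.

(** * Stability *)

Lemma eq_regular_seq (S : comNzRingType) (M J J' : S -> Prop) s : is_ideal J ->
  (forall f, J f <-> J' f) -> regular_seq M J s -> regular_seq M J' s.
Proof.
move=> idJ e; have idJ' := eq_is_ideal e idJ.
move=> /(regular_seqP _ _ idJ) [sM regs n1]; apply/(regular_seqP _ _ idJ').
split=> //; first exact: eq_weakly_regular regs.
by move=> /(eq_ideal_adds s e).
Qed.

Lemma eq_is_grade (S : comNzRingType) (M J J' : S -> Prop) r : is_ideal J ->
  (forall f, J f <-> J' f) -> is_grade M J r -> is_grade M J' r.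
Proof.
move=> idJ e [[s sr regs] maxr]; split; first by exists s => //; apply: eq_regular_seq regs.
move=> t regt; apply: maxr; apply: eq_regular_seq regt; last by move=> f; rewrite e.
exact: eq_is_ideal idJ.
Qed.

Lemma is_grade_unique (S : comNzRingType) (M J : S -> Prop) r r' :
  is_grade M J r -> is_grade M J r' -> r = r'.
Proof.
move=> [[s <- regs] maxr] [[s' <- regs'] maxr'].
by apply/eqP; rewrite eqn_leq maxr' // maxr.
Qed.

Section Stability.
Variables (K : fieldType) (n k d : nat) (al be b : nat -> nat).
Hypothesis H : plp n k d al be b.

Notation slack := (plp_slack n k d be b).
Notation tight := (plp_tight n k d al be b).
Notation degenerate := (plp_degenerate n k d al be b).
Notation up m := (plp_up k (m * d) (fun i => m * al i) (fun i => m * be i)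
  (fun i => m * b i)).
Notation I := (@base_ideal n k d al be b K).

Lemma exp_up m f : 0 < m -> ideal_exp I m f <-> monideal (up m) f.
Proof. exact: base_ideal_exp. Qed.

Definition power_rank m := if degenerate then 0 else minn (n - k - tight) (m * slack).

Lemma exp_depth m : 0 < m ->
  is_depth (ideal_exp I m) (n - (plp_path_rank al be k + power_rank m + 1)).
Proof.
move=> m0; have Hm := plp_scaled H m0.
apply: (@eq_is_grade _ _ (monideal (up m))) => [|f|].
- exact: (monideal_ideal K (plp_up_upclosed Hm)).
- by rewrite exp_up.
have := plp_depth Hm K.
by rewrite path_rank_scaled // /plp_tail_rank degenerate_scaled // tight_scaled // slack_scaled.
Qed.

Lemma exp_same_depth m m' : 0 < m -> 0 < m' ->
  same_depth (ideal_exp I m) (ideal_exp I m') <-> power_rank m = power_rank m'.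
Proof.
move=> m0 m0'; split=> [[r dr dr']|e]; last first.
  by exists (n - (plp_path_rank al be k + power_rank m + 1)); [|rewrite e]; apply: exp_depth.
(* The ranks stay within [n], so the truncated subtraction loses nothing and the depth determines
   [power_rank]. *)
have le j : 0 < j -> plp_path_rank al be k + power_rank j + 1 <= n.
  move=> j0; have := sum_cut (plp_scaled H j0).
  rewrite path_rank_scaled // /plp_tail_rank degenerate_scaled // tight_scaled //.
  by rewrite slack_scaled // -/(power_rank j); lia.
have := is_grade_unique dr (exp_depth m0); have := is_grade_unique dr' (exp_depth m0').
by have := le m m0; have := le m' m0'; lia.
Qed.

Lemma exp_Ass m P : 0 < m -> in_Ass (ideal_exp I m) P <->
  exists2 F, mon_assoc (up m) F & forall f, P f <-> monideal (meets F) f.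
Proof.
move=> m0; have Hm := plp_scaled H m0; have upU := plp_up_upclosed Hm.
split=> [asP|[F asF PF]].
  apply: (@Ass_mon_assoc K n (up m) (m * d)) => //; first exact: plp_up_bounded Hm.
  by apply: eq_in_Ass asP => f //; rewrite exp_up.
apply: (@eq_in_Ass K n (monideal (up m)) _ (monideal (meets F))).
- by move=> f; rewrite exp_up.
- by move=> f; rewrite PF.
exact: mon_assoc_Ass.
Qed.

Lemma exp_same_Ass m m' : 0 < m -> 0 < m' ->
  same_Ass (ideal_exp I m) (ideal_exp I m') <->
  forall F : {set 'I_n}, mon_assoc (up m) F <-> mon_assoc (up m') F.
Proof.
move=> m0 m0'; split=> [same F|same P]; last first.
  by rewrite !exp_Ass //; split=> -[F /same asF PF]; exists F.
suff sub j j' : 0 < j -> 0 < j' ->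
    (forall P, in_Ass (ideal_exp I j) P -> in_Ass (ideal_exp I j') P) ->
    mon_assoc (up j) F -> mon_assoc (up j') F.
  by split; apply: sub => // P /same.
move=> j0 j0' sjj' asF.
have /sjj' : in_Ass (ideal_exp I j) (monideal (meets F)) by apply/exp_Ass => //; exists F.
by case/(exp_Ass _ j0') => F' asF' /meets_inj ->.
Qed.

Definition stable_power m := [|| degenerate, slack == 0 | n - k - tight <= m * slack].

Lemma stable_power_rank m m' : m <= m' -> stable_power m ->
  power_rank m = power_rank m'.
Proof.
move=> le /or3P[deg|/eqP s0|ge]; rewrite /power_rank ?deg //.
  by rewrite s0 !muln0.
have : m * slack <= m' * slack by rewrite leq_mul2r le orbT.
by case: ifP => // _; lia.
Qed.

(** A single repetition suffices: a minimum with [m * slack] grows strictly until it reaches the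
    constant. *)
Lemma power_rank_stable m : power_rank m = power_rank m.+1 -> stable_power m.
Proof.
rewrite /power_rank /stable_power; case: ifP => //= _; rewrite mulSn.
by case: eqP => //= s0; lia.
Qed.

(* Only primes of tail type depend on m, through the bound on the number of   *)
(* their tail variables.                                                      *)
Lemma stable_power_assoc m m' (F : {set 'I_n}) : m <= m' -> 0 < m -> stable_power m ->
  mon_assoc (up m) F <-> mon_assoc (up m') F.
Proof.
move=> le m0 st; have m0' : 0 < m' by exact: leq_trans le.
have lem : m * slack <= m' * slack by rewrite leq_mul2r le orbT.
rewrite !mon_assoc_scaled //; split=> -[pF|[j [A [tF cA]]]]; try by left.
  by right; exists j, A; split=> //; lia.
right; exists j, A; split=> //.
have [jk A0 FE [bd lowd] cond] := tF.
have cn : tail_card n k A <= n - k.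
  rewrite -[n - k]muln1 -sum_nat_const_nat /tail_card; apply: leq_sum => l _.
  by case: (A l).
have kn := plp_k H.
have tj : (j == k) || ~~ tight.
  case: eqP => //= ne; have := cond k ltac:(lia).
  by rewrite /plp_tight; lia.
case/or3P: st => [deg|/eqP s0|ge].
- exfalso; move: deg tj => /andP[-> /eqP bd']; rewrite orbF => /eqP e.
  by move: bd; rewrite e bd'; lia.
- by move: cA; rewrite s0 !muln0.
by case/orP: tj ge => [->|/negbTE ->]; case: tight => /=; lia.
Qed.

(** Before the threshold, a prime containing all tail variables is missing for [m] but present for
    [m + n]. It has no path variables if the constraint at [k] is tight, and some otherwise; this
    matches the extra unit in its bound. *)
Lemma assoc_stable_power m : 0 < m ->
  (forall m', m <= m' -> forall F : {set 'I_n},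
     mon_assoc (up m) F <-> mon_assoc (up m') F) ->
  stable_power m.
Proof.
move=> m0 same; apply: contraT => nst; have /andP[k0 kn] := plp_k H.
move: nst; rewrite /stable_power !negb_or -ltnNge => /and3P[ndeg s0 lt].
have bed := plp_bed H.
pose A : pred nat := predT.
have offA : btail_off n k b A = 0 by rewrite /btail_off big_pred0.
have cardA : tail_card n k A = n - k by rewrite /tail_card sum_nat_const_nat muln1.
have key (F : {set 'I_n}) j : tail_type k d al be b F j A -> (j == k) = tight -> False.
  move=> tF ejt; have [jk _ FE _ _] := tF.
  have bound : n - k <= (m + n) * slack by rewrite mulnDl; nia.
  have asF : mon_assoc (up (m + n)) F.
    apply/(mon_assoc_scaled H); first by lia.
    by right; exists j, A; split=> //; rewrite cardA; lia.
  have tailF l (ln : l < n) : k <= l -> Ordinal ln \in F.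
    by rewrite FE /= => ->; rewrite orbT.
  have /(same _ (leq_addr n m)) /(mon_assoc_scaled H m0) := asF.
  case=> [[j' [i [/andP[_ ik] FE' _ _]]]|[j' [A' [[jk' _ FE' _ _] cA']]]].
    by have := tailF k kn (leqnn k); rewrite FE' /=; lia.
  have {}cA' : n - k <= m * slack + (j' == k).
    apply: leq_trans cA'; rewrite -cardA /tail_card !big_nat.
    apply: leq_sum => l /andP[kl ln]; have := tailF l ln kl.
    by rewrite FE' /= kl; case: (A' l) => //; lia.
  (* [F] itself shows whether it contains path variables. *)
  have ejj : (j' == k) = (j == k).
    apply/eqP/eqP => [e|e].
      case: (ltnP j k) => jk2; last by lia.
      have jn : j < n by lia.
      have : Ordinal jn \in F by rewrite FE /= leqnn jk2.
      by rewrite FE' /=; lia.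
    case: (ltnP j' k) => jk2; last by lia.
    have jn : j' < n by lia.
    have : Ordinal jn \in F by rewrite FE' /= leqnn jk2.
    by rewrite FE /=; lia.
  by move: lt cA'; rewrite ejj ejt; lia.
have lowk := low_le_be H (leqnn k).
case: (boolP tight) => [t|nt].
  case: (key [set v : 'I_n | k <= v] k); last by rewrite eqxx.
  split=> //.
  - by rewrite cardA subn_gt0.
  - by move=> v; rewrite inE andbT; lia.
  - rewrite offA addn0 ltnn; split=> //.
    by move: ndeg; rewrite /plp_degenerate t /=; lia.
  - by move=> p; lia.
have bk : be 1 <= be k := be_mono H k0 (leqnn k).
have ex0 : exists j, (j < k) && (be j < be k).
  by exists 0; rewrite k0 (plp_be0 H); have := plp_be1 H; lia.
(* The largest such [j] makes [be] constant after [j], so both conditions of [tail_type] reduce to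
   comparisons with [be k]. *)
case: (ex_maxnP (m := k) ex0) => [j /andP[/ltnW]//|j /andP[jk bj] jmax].
have bp p : j < p <= k -> be p = be k.
  move=> /andP[jp pk]; have := be_mono H pk (leqnn k).
  rewrite leq_eqVlt => /predU1P [//|lt'].
  have pk' : p < k by move: pk; rewrite leq_eqVlt => /predU1P [e|//]; rewrite e ltnn in lt'.
  by have := jmax p; rewrite pk' lt' => /(_ isT); lia.
rewrite /plp_tight in nt.
case: (key [set v : 'I_n | j <= v] j); last by rewrite /plp_tight; lia.
split=> //.
- exact: ltnW.
- by rewrite cardA subn_gt0.
- by move=> v; rewrite inE andbT; lia.
- by rewrite offA !addn0; split; lia.
move=> p jp; rewrite (bp p jp); split=> //.
case/andP: jp => jp pk; move: pk; rewrite leq_eqVlt => /predU1P [->|pk]; first by lia.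
rewrite low_al //; have := al_mono H (ltnW pk) (leqnn k).
by have := al_low n d al b (leqnn k); lia.
Qed.

Lemma base_ideal_stability : exists2 m, is_astab I m & is_dstab I m.
Proof.
have exst : exists m, (0 < m) && stable_power m.
  (* A nonzero slack is at least 1, hence [n * slack >= n - k]. *)
  exists n; have := plp_k H => /andP[k0 kn]; rewrite /stable_power.
  by case: eqP => [|s0]; rewrite ?orbT; [lia | nia].
case: (ex_minnP exst) => m /andP[m0 st] mmin; exists m; split.
- split=> // l ml; apply/exp_same_Ass => //; first exact: leq_trans ml.
  by move=> F; apply: stable_power_assoc.
- move=> m' [m0' same]; apply: mmin; rewrite m0' /=; apply: assoc_stable_power => // l ml.
  by apply/exp_same_Ass; [|exact: leq_trans ml|exact: same].
- split=> // l ml; apply/exp_same_depth => //; first exact: leq_trans ml.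
  exact: stable_power_rank.
move=> m' [m0' same]; apply: mmin; rewrite m0' /=; apply: power_rank_stable.
by apply/exp_same_depth => //; apply: same.
Qed.

End Stability.

(** * Transfer to the original data *)

Lemma eq_ideal_gen (S : comNzRingType) (G G' : S -> Prop) :
  (forall f, G f <-> G' f) -> forall f, ideal_gen G f <-> ideal_gen G' f.
Proof.
by move=> e f; split=> -[r [c [g [Gg ->]]]]; exists r, c, g; split=> // i; apply/e.
Qed.

Lemma eq_ideal_exp (S : comNzRingType) (J J' : S -> Prop) m :
  (forall f, J f <-> J' f) -> forall f, ideal_exp J m f <-> ideal_exp J' m f.
Proof.
move=> e; apply: eq_ideal_gen => f.
by split=> -[g [Jg ->]]; exists g; split=> // i; apply/e.
Qed.

Lemma eq_least_stable (E E' : nat -> nat -> Prop) m :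
  (forall i j, E i j <-> E' i j) -> least_stable E m -> least_stable E' m.
Proof.
move=> e; have st i : stable_from E i <-> stable_from E' i.
  by split=> -[i0 s]; split=> // l /s /e.
by move=> [/st sm minm]; split=> // m' /st; apply: minm.
Qed.

Section Normalization.
Variables (n k d : nat) (alpha beta b : nat -> nat).

(** The given values at index 0 are arbitrary, whereas the empty prefix has sum 0. *)
Definition zero_at0 (f : nat -> nat) i := if i == 0 then 0 else f i.

Lemma right_PLP_plp : right_PLP_data n k d alpha beta b ->
  plp n k d (zero_at0 alpha) (zero_at0 beta) b.
Proof.
case=> kn d0 ab am ad b1 bm bd bp dle.
have e (f : nat -> nat) i : 0 < i -> zero_at0 f i = f i by rewrite /zero_at0; case: i.
have k0 : 0 < k by lia.
have mono (f : nat -> nat) :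
    (forall i j, 1 <= i -> i <= j -> j <= k -> f i <= f j) ->
    forall i j, i <= j <= k -> zero_at0 f i <= zero_at0 f j.
  move=> fm [|i] j ij //; rewrite !e; [|lia|lia].
  by apply: fm; lia.
split=> //; try exact: mono; try by rewrite ?e.
- lia.
- by move=> [|i] ik //; rewrite !e //; apply: ab; lia.
- by move=> j kj; apply: bp; lia.
by rewrite e //; rewrite big_add1 /= in dle.
Qed.

Lemma right_PLP_base (u : 'X_{1..n}) : k <= n ->
  right_PLP_exponent k d alpha beta b u <->
  plp_base k d (zero_at0 alpha) (zero_at0 beta) b u.
Proof.
move=> kn; split=> -[ual ub ud]; split.
- move=> [|i] ik; first by rewrite cum0.
  by rewrite cumE; [apply: ual | lia].
- by move=> j /andP[kj jn]; have := ub (Ordinal jn) kj; rewrite -expoE.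
- by rewrite cum_mdeg.
- by move=> [|i] // ik; have := ual i.+1 ik; rewrite cumE; last by lia.
- by move=> j kj; have := ub j; rewrite expoE kj ltn_ord; apply.
by rewrite -cum_mdeg.
Qed.

End Normalization.

Theorem corollary6p15 (K : fieldType) (n k d : nat) (alpha beta b : nat -> nat)
    (hPLP : right_PLP_data n k d alpha beta b) :
  exists2 m : nat, is_astab (@right_PLP_ideal K n k d alpha beta b) m
                 & is_dstab (@right_PLP_ideal K n k d alpha beta b) m.
Proof.
have H := right_PLP_plp hPLP.
have kn : k <= n by have := plp_k H; lia.
have eI f : @base_ideal n k d (zero_at0 alpha) (zero_at0 beta) b K f <->
    right_PLP_ideal k d alpha beta b f.
  by apply: eq_ideal_gen => g; split=> -[u bu ->]; exists u => //; apply/right_PLP_base.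
have eIm m := eq_ideal_exp m eI.
have idm m : is_ideal (ideal_exp (@base_ideal n k d (zero_at0 alpha) (zero_at0 beta) b K) m).
  exact: ideal_gen_ideal.
have idm' m : is_ideal (ideal_exp (@right_PLP_ideal K n k d alpha beta b) m).
  exact: ideal_gen_ideal.
have [m astab dstab] := base_ideal_stability K H; exists m.
  apply: eq_least_stable astab => i j.
  have eAss m' P : in_Ass (ideal_exp (@base_ideal n k d (zero_at0 alpha) (zero_at0 beta) b K) m') P <->
      in_Ass (ideal_exp (@right_PLP_ideal K n k d alpha beta b) m') P.
    by split; apply: eq_in_Ass => f; rewrite ?eIm.
  by split=> same P; have := same P; rewrite !eAss.
apply: eq_least_stable dstab => i j.
have eIm' m' f := iff_sym (eIm m' f).
split=> -[r di dj]; exists r.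
- exact: (eq_is_grade (idm i) (eIm i) di).
- exact: (eq_is_grade (idm j) (eIm j) dj).
- exact: (eq_is_grade (idm' i) (eIm' i) di).
exact: (eq_is_grade (idm' j) (eIm' j) dj).
Qed.
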